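(* A Haar-random unitary $U\in\mathrm{U}(4)$ is almost surely 2-universal; that is, with respect to the Haar probability measure on $\mathrm{U}(4)$, almost every $U$ is 2-universal.
   Context: $T$ is the $4\times4$ swap matrix on $\mathbb{C}^2\otimes\mathbb{C}^2$, i.e. $T(x\otimes y)=y\otimes x$; in the standard basis $T=\begin{pmatrix}1&0&0&0\\0&0&1&0\\0&1&0&0\\0&0&0&1\end{pmatrix}$. A two-qubit unitary $U\in\mathrm{U}(4)$ is 2-universal if for every $V\in\mathrm{U}(4)$ and every $\varepsilon>0$ there exist $l\in\mathbb{N}$ and nonnegative integers $N_1,\dots,N_l$ such that $\|V-U^{N_l}\cdots U^{N_3}(TUT)^{N_2}U^{N_1}\|_\infty<\varepsilon$ (powers of $U$ and of $TUT$ alternate), where $\|\cdot\|_\infty$ is the spectral (operator) norm. *)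

(* Defs.v *)
From HB Require Import structures.
From mathcomp Require Import all_boot all_order all_algebra.
From mathcomp Require Import sesquilinear spectral complex mxtens.
From mathcomp Require Import all_classical all_reals all_analysis.
Import Order.TTheory GRing.Theory Num.Theory numFieldNormedType.Exports.

Set Implicit Arguments.
Unset Strict Implicit.
Unset Printing Implicit Defensive.

Local Open Scope classical_set_scope.
Local Open Scope ring_scope.
Local Open Scope complex_scope.

(* The topology of R[i] given by its modulus; it makes 'M[R[i]]_n a topological
   space (entrywise convergence). *)
#[non_forgetful_inheritance]
HB.instance Definition _ (R : realType) := NormedModule.copy R[i] R[i]^o.

Section spectral_norm.
Context {R : realType}.

Definition l2norm n (x : 'cV[R[i]]_n) : R :=
  Num.sqrt (\sum_(i < n) Normc.normc (x i 0) ^+ 2).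

Definition opnorm m n (A : 'M[R[i]]_(m, n)) : R :=
  sup [set l2norm (A *m x) | x in [set x | l2norm x <= 1]].

End spectral_norm.

Section unitary_group.
Variable R : realType.

(* U(4), with the subspace topology inherited from 'M[R[i]]_4. *)
Definition unitary4 : set 'M[R[i]]_4 := [set U | U \is unitarymx].

Definition U4 : Type := set_type unitary4.

HB.instance Definition _ := Topological.on U4.

Definition U4mx (U : U4) : 'M[R[i]]_4 := set_val U.

Lemma U4mxP (U : U4) : U4mx U \is unitarymx.
Proof. by case: U => U hU; exact: (set_mem hU). Qed.

Definition mkU4 (U : 'M[R[i]]_4) (hU : U \is unitarymx) : U4 :=
  exist _ U (mem_set (hU : unitary4 U)).

Lemma mkU4K (U : 'M[R[i]]_4) (hU : U \is unitarymx) : U4mx (mkU4 hU) = U.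
Proof. by []. Qed.

Lemma unitarymx1 : (1%:M : 'M[R[i]]_4) \is unitarymx.
Proof. by apply/unitarymxP; rewrite mul1mx trmx1 map_mx1. Qed.

HB.instance Definition _ := isPointed.Build U4 (mkU4 unitarymx1).

Definition U4mul (V U : U4) : U4 := mkU4 (mul_unitarymx (U4mxP V) (U4mxP U)).

Definition borelU4 := g_sigma_algebraType (@open U4).

(* U(4) is compact, so left invariance determines the Haar probability measure
   uniquely (and implies right invariance). *)
Definition haar (mu : probability borelU4 R) : Prop :=
  forall (V : U4) (A : set borelU4), measurable A -> mu (U4mul V @` A) = mu A.

End unitary_group.

Section two_universality.
Context {R : realType}.

Definition swapmx : 'M[R[i]]_4 :=
  \matrix_(i < 4, j < 4)
    (nth [::] [:: [:: 1; 0; 0; 0];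
                  [:: 0; 0; 1; 0];
                  [:: 0; 1; 0; 0];
                  [:: 0; 0; 0; 1]] i)`_j.

Lemma swapmx_tens (x y : 'cV[R[i]]_2) :
  swapmx *m (tensmx x y : 'cV[R[i]]_4) = tensmx y x.
Proof.
apply/matrixP => i j; rewrite !mxE !big_ord_recl big_ord0 !mxE.
rewrite !ord1.
case: i => -[|[|[|[|//]]]] hi; rewrite /= !(mul0r, mul1r, add0r, addr0) mulrC;
  by congr (y _ _ * x _ _); apply/val_inj.
Qed.

(* B and A alternate from the right, starting with A:
   ... A ^+ N 3 * B ^+ N 2 * A ^+ N 1, with l factors. *)
Fixpoint alt_word (A B : 'M[R[i]]_4) (N : nat -> nat) (l : nat) : 'M[R[i]]_4 :=
  if l is k.+1 then (if odd l then A else B) ^+ N l * alt_word A B N k else 1.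

Definition two_universal (U : U4 R) : Prop :=
  forall (V : U4 R) (eps : R), 0 < eps ->
  exists (l : nat) (N : nat -> nat),
    opnorm (U4mx V - alt_word (U4mx U) (swapmx * U4mx U * swapmx) N l) < eps.

End two_universality.

(* Main.v *)
(** Let [s] be the singlet vector, so that [T] is the reflection in the
    hyperplane orthogonal to [s].  For almost every [U], the vector [s] has a
    nonzero coordinate along every eigenvector of [U] and the eigenvalues of
    [U] satisfy no multiplicative relation: both are conditions of
    nonvanishing of polynomials in the entries of [U], and the zero set of a
    polynomial that does not vanish identically on U(4) is Haar-null.  For
    such [U], Kronecker's theorem puts the whole maximal torus through [U] in
    the closure [G] of the words in [U] and [TUT]; in particular [G] contains
    the complex reflections [refl a z = 1 + (z - 1) a^* a] along the
    eigenvectors [a] of [U], and, [G] being stable under conjugation by [T],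
    the reflections along the vectors [a T].

    No Lie theory is needed to conclude: the set [L] of unit vectors [a] with
    all [refl a z] in [G] is compact and stable under the reflections along
    its elements.  Given a unit vector [y], let [x] in [L] maximise the real
    part of [<x, y>].  Moving [x] by [refl a z] shows that [<x, a> <a, y>] is
    real and nonnegative for all [a] in [L]; polarising along the eigenbasis
    and one vector with no zero coordinate yields [x = y].  Hence [L] is the
    whole sphere, and reflections generate U(4) by the spectral theorem.

    For null sets, let [f] be a polynomial, [S] a set of matrices, and [E] the
    set of [U] with [f (g U) = 0] for all [g] in [S] but
    [f (g (refl a z) U) != 0] for some [g] in [S] and some [z].  Each [U] lies
    in at most [deg f] of the translates of [E] by [refl a z], which all have
    the same measure, so [E] is null.  Words in five one-parameter groups of
    reflections are dense in U(4), again by the previous argument, so countably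
    many such [E] cover the zeros of [f]. *)
Require Import Defs.
From mathcomp Require Import all_boot all_order all_algebra all_fingroup.
From mathcomp Require mpoly.
Import Order.TTheory GRing.Theory Num.Theory.
Set Implicit Arguments.
Unset Strict Implicit.
Unset Printing Implicit Defensive.
Local Open Scope ring_scope.

(** * Symmetric polynomials and Vieta's formulas *)

Module SymmetricFunctions.
Import mpoly.

(** The right-hand side is symmetric in the entries of [lam], hence a polynomial in the elementary
    symmetric functions, which Vieta's formulas identify with signed coefficients of the monic
    polynomial with roots [lam]. The list [r] holds the coefficients and exponents of that
    polynomial. *)
Lemma symmetrized_relation (C : idomainType) n (a b : 'I_n -> nat) :
  exists r : seq (C * ('I_n -> nat)), forall lam : n.-tuple C,
    \sum_(cm <- r) cm.1 * \prod_(i < n)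
      ((-1) ^+ i.+1 * (\prod_(c <- lam) ('X - c%:P))`_(n - i.+1)) ^+ cm.2 i
    = \prod_(s : 'S_n) (\prod_i tnth lam (s i) ^+ a i
                        - \prod_i tnth lam (s i) ^+ b i).
Proof.
pose X (c : 'I_n -> nat) : {mpoly C[n]} := 'X_[[multinom c i | i < n]].
pose h := X a - X b.
pose p := \prod_(s : 'S_n) msym s h.
have p_sym : p \is symmetric.
  apply/issymP => s; rewrite /p rmorph_prod /=.
  rewrite [RHS](reindex_inj (mulIg s)); apply: eq_bigr => s' _.
  by rewrite msymMm.
have [t [tE _]] := sym_fundamental p_sym.
exists [seq (t@_m, m : 'I_n -> nat) | m <- msupp t] => lam.
rewrite big_map -mevalE.
have -> : t.@[fun i => (-1) ^+ i.+1 *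
    (\prod_(c <- lam) ('X - c%:P))`_(n - i.+1)] = p.@[tnth lam].
  rewrite -tE comp_mpoly_meval; apply: meval_eq => i.
  have := mroots_coeff lam (lift ord0 i); rewrite /= => ->.
  by rewrite mulrA -exprMn mulrNN mulr1 expr1n mul1r tnth_mktuple.
rewrite /p rmorph_prod /=; apply: eq_bigr => s _.
have msymE c : (msym s (X c)).@[tnth lam] = \prod_i tnth lam (s i) ^+ c i.
  rewrite /X msymX mevalX (reindex_inj (@perm_inj _ s)); apply: eq_bigr => i _.
  by rewrite !mnmE permK.
by rewrite /h raddfB /= mevalB !msymE.
Qed.

End SymmetricFunctions.

From mathcomp Require Import sesquilinear spectral complex.
From mathcomp Require Import ring.
From mathcomp Require Import all_classical all_reals all_analysis.
From mathcomp Require Import measurable_realfun.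
Import numFieldNormedType.Exports.
Local Open Scope classical_set_scope.
Local Open Scope sesquilinear_scope.

(** * Complex reflections *)

Section Reflections.
Variables (C : numClosedFieldType) (n : nat).
Implicit Types (a b f u v w x y : 'rV[C]_n) (z : C).

(** Vectors are rows acted on from the right, so for unitary [P] the eigenvectors of
    [P^t* *m diag_mx d *m P] are the rows of [P]. *)
Definition dot u v : C := (u *m v^t*) 0 0.

Lemma dotE u v : dot u v = \sum_i u 0 i * (v 0 i)^*.
Proof. by rewrite /dot mxE; apply: eq_bigr => i _; rewrite !mxE. Qed.

Lemma dotDl u1 u2 v : dot (u1 + u2) v = dot u1 v + dot u2 v.
Proof. by rewrite /dot mulmxDl mxE. Qed.

Lemma dotZl c u v : dot (c *: u) v = c * dot u v.
Proof. by rewrite /dot -scalemxAl mxE. Qed.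

Lemma dotC u v : dot u v = (dot v u)^*.
Proof.
rewrite !dotE rmorph_sum; apply: eq_bigr => i _.
by rewrite rmorphM /= conjCK mulrC.
Qed.

Lemma dotDr u v1 v2 : dot u (v1 + v2) = dot u v1 + dot u v2.
Proof. by rewrite dotC dotDl rmorphD /= -!dotC. Qed.

Lemma dotZr c u v : dot u (c *: v) = c^* * dot u v.
Proof. by rewrite dotC dotZl rmorphM /= -dotC. Qed.

Lemma dot0l v : dot 0 v = 0.
Proof. by rewrite /dot mul0mx mxE. Qed.

Lemma dot0r v : dot v 0 = 0.
Proof. by rewrite dotC dot0l conjC0. Qed.

Lemma dot_suml (I : finType) (F : I -> 'rV[C]_n) v :
  dot (\sum_i F i) v = \sum_i dot (F i) v.
Proof. by rewrite /dot mulmx_suml summxE. Qed.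

Lemma dot_eq0 u : (dot u u == 0) = (u == 0).
Proof.
rewrite dotE; apply/idP/eqP => [|->]; last first.
  by rewrite big1 // => i _; rewrite mxE mul0r.
rewrite psumr_eq0 => [/allP u0|i _]; last by rewrite -normCK exprn_ge0.
apply/rowP => i; have := u0 i (mem_index_enum _).
by rewrite -normCK expf_eq0 /= normr_eq0 mxE => /eqP.
Qed.

Lemma dot_mulmx u v (M : 'M[C]_n) : dot (u *m M) v = dot u (v *m M^t*).
Proof. by rewrite /dot trmx_mul map_mxM /= trmxCK mulmxA. Qed.

Lemma mulmx_outer u v w : u *m (v^t* *m w) = dot u v *: w.
Proof.
rewrite mulmxA [u *m _]mx11_scalar mul_scalar_mx.
by congr (_ *: _).
Qed.

Lemma dot_unitary (P : 'M[C]_n) u v :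
  P \is unitarymx -> dot (u *m P) (v *m P) = dot u v.
Proof.
by move=> /unitarymxP PP; rewrite dot_mulmx -mulmxA PP mulmx1.
Qed.

Lemma unitarymx_trC (P : 'M[C]_n) : P \is unitarymx -> P^t* *m P = 1%:M.
Proof. by rewrite -trmxC_unitary => /unitarymxP; rewrite trmxCK. Qed.

Lemma unitary_conj_mul (P A B : 'M[C]_n) : P \is unitarymx ->
  (P^t* *m A *m P) *m (P^t* *m B *m P) = P^t* *m (A *m B) *m P.
Proof.
by move=> /unitarymxP PP; rewrite !mulmxA -(mulmxA _ P) PP mulmx1.
Qed.

Lemma dot_row (P : 'M[C]_n) i j :
  P \is unitarymx -> dot (row i P) (row j P) = (i == j)%:R.
Proof.
move=> /unitarymxP /matrixP /(_ i j); rewrite !mxE => <-.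
by rewrite dotE; apply: eq_bigr => k _; rewrite !mxE.
Qed.

Lemma row_expansion (P : 'M[C]_n) u : P \is unitarymx ->
  u = \sum_i dot u (row i P) *: row i P.
Proof.
move=> Pu; have PP := unitarymx_trC Pu.
rewrite -{1}[u]mulmx1 -PP mulmxA mulmx_sum_row; apply: eq_bigr => i _.
congr (_ *: _); rewrite dotE !mxE; apply: eq_bigr => k _.
by rewrite !mxE.
Qed.

Definition refl a z : 'M[C]_n := 1%:M + (z - 1) *: (a^t* *m a).

Lemma mul_refl x a z : x *m refl a z = x + ((z - 1) * dot x a) *: a.
Proof. by rewrite mulmxDr mulmx1 -scalemxAr mulmx_outer scalerA. Qed.

Lemma refl1 a : refl a 1 = 1%:M.
Proof. by rewrite /refl subrr scale0r addr0. Qed.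

Lemma refl_mul a z1 z2 :
  dot a a = 1 -> refl a z1 *m refl a z2 = refl a (z1 * z2).
Proof.
move=> a1; apply/row_matrixP => i; rewrite !rowE mulmxA !mul_refl.
rewrite dotDl dotZl a1 -addrA -scalerDl; congr (_ + _ *: _); ring.
Qed.

Lemma refl_tr a z : (refl a z)^t* = refl a z^*.
Proof.
rewrite /refl linearD /= map_mxD trmx1 map_mx1 linearZ /= map_mxZ.
rewrite [X in X *: _]rmorphB /= conjC1; congr (_ + _ *: _).
by rewrite trmx_mul map_mxM /= trmxCK.
Qed.

Lemma conj_unit z : `|z| = 1 -> z * z^* = 1.
Proof. by move=> z1; rewrite -normCK z1 expr1n. Qed.

Lemma refl_unitary a z : dot a a = 1 -> `|z| = 1 -> refl a z \is unitarymx.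
Proof.
move=> a1 z1; apply/unitarymxP.
by rewrite refl_tr refl_mul // conj_unit // refl1.
Qed.

Lemma refl_conj a z (P : 'M[C]_n) : P \is unitarymx ->
  P^t* *m refl a z *m P = refl (a *m P) z.
Proof.
move=> Pu; have PP := unitarymx_trC Pu.
rewrite /refl mulmxDr mulmxDl mulmx1 PP -scalemxAr -scalemxAl.
by rewrite trmx_mul map_mxM /= !mulmxA.
Qed.

(** Reflections along the rows of [P] lie in the maximal torus diagonalised by [P]; this is how
    torus elements yield reflections. *)
Lemma refl_row (P : 'M[C]_n) i z : P \is unitarymx ->
  refl (row i P) z
  = P^t* *m diag_mx (\row_j (if j == i then z else 1)) *m P.
Proof.
move=> Pu; rewrite rowE -refl_conj //; congr (_ *m _ *m _).
apply/matrixP => j k; rewrite !mxE big_ord1 !mxE eqxx /=.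
rewrite rmorph_nat -natrM mulnb.
have [<-|jk] := eqVneq j k; last first.
  case: (eqVneq j i) => [ji|_]; last by rewrite mulr0 addr0.
  by rewrite -ji [k == j]eq_sym (negbTE jk) mulr0 addr0.
case: (j == i); rewrite /= ?mulr1 ?mulr0 ?addr0 //.
by rewrite mulr1n addrC subrK.
Qed.

(** * Rigidity of a maximising point *)

Section MaximalPoint.
Variables (L : 'rV[C]_n -> Prop) (P : 'M[C]_n) (w x y : 'rV[C]_n).
Hypotheses (Pu : P \is unitarymx) (LP : forall i, L (row i P)) (Lw : L w).
Hypothesis wP : forall i, dot w (row i P) != 0.
Hypothesis L_refl :
  forall a b z, L a -> L b -> `|z| = 1 -> L (b *m refl a z).
Hypothesis xy_ge0 : forall a, L a -> 0 <= dot x a * dot a y.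

(* The sesquilinear form of the skew-hermitian matrix [y^* x - x^* y]. *)
Let B u v := dot u y * dot x v - dot u x * dot y v.

Let BDl u1 u2 v : B (u1 + u2) v = B u1 v + B u2 v.
Proof. by rewrite /B !dotDl; ring. Qed.

Let BZl c u v : B (c *: u) v = c * B u v.
Proof. by rewrite /B !dotZl; ring. Qed.

Let BDr u v1 v2 : B u (v1 + v2) = B u v1 + B u v2.
Proof. by rewrite /B !dotDr; ring. Qed.

Let BZr c u v : B u (c *: v) = c^* * B u v.
Proof. by rewrite /B !dotZr; ring. Qed.

Let B_diag a : L a -> B a a = 0.
Proof.
move=> /xy_ge0 /geC0_conj; rewrite rmorphM /= -!dotC /B => ->.
by rewrite mulrC subrr.
Qed.

(** Polarisation: [a *m refl f z] stays in [L], so the quadratic form of [B] vanishes on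
    [a + (z - 1) d f] for every [z] of modulus one. *)
Let B_row a f : L a -> L f -> dot a f != 0 -> B f a = 0 /\ B a f = 0.
Proof.
move=> La Lf af0; set d := dot a f in af0.
have step z : `|z| = 1 ->
    ((z - 1) * d) * B f a + ((z - 1) * d)^* * B a f = 0.
  move=> z1; have := B_diag (L_refl Lf La z1).
  rewrite mul_refl BDl !BDr !BZl !BZr !B_diag // => <-.
  rewrite /d; ring.
(* The equations at [z = -1] and [z = 'i] are independent, which separates [B f a] from [B a f]. *)
have i1 : `|'i : C| = 1 by rewrite normCi.
have h1 := step (-1) (normrN1 _); have h2 := step 'i i1.
rewrite !rmorphM !rmorphB /= rmorphN /= !conjC1 conjCi in h1 h2.
have n2 : (2 : C) != 0 by rewrite pnatr_eq0.
have e1 : d * B f a + d^* * B a f = 0.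
  apply: (mulfI n2); rewrite mulr0.
  apply/eqP; rewrite -oppr_eq0; apply/eqP; rewrite -[RHS]h1; ring.
have e2 : 'i * 2 * (d * B f a) = 0.
  transitivity (('i - 1) * d * B f a + (- 'i - 1) * d^* * B a f
    + ('i + 1) * (d * B f a + d^* * B a f)); first by ring.
  by rewrite e1 mulr0 addr0 h2.
have i0 : ('i * 2 : C) != 0 by rewrite mulf_neq0 // neq0Ci.
have e3 : d * B f a = 0 by apply: (mulfI i0); rewrite mulr0.
split; first by apply: (mulfI af0); rewrite mulr0.
have d0 : d^* != 0 by rewrite conjC_eq0.
by apply: (mulfI d0); rewrite mulr0 -e1 e3 add0r.
Qed.

Let B0r a : L a -> (forall i, dot a (row i P) != 0) -> forall u, B u a = 0.
Proof.
move=> La aP u; rewrite (row_expansion u Pu).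
elim/big_rec: _ => [|i v _ Bv]; first by rewrite /B !dot0l !mul0r subrr.
by rewrite BDl BZl Bv addr0 (B_row La (LP i) (aP i)).1 mulr0.
Qed.

(** The vector [w] and its images under the reflections with [z = -1] along the rows of [P] lie in
    the right radical of [B]. Their differences span, so [B = 0] and [x] is a multiple of [y], by a
    factor that positivity forces to be 1. *)
Lemma positive_products_eq : dot x x = 1 -> dot y y = 1 -> x = y.
Proof.
move=> x1 y1.
have m11 : `|-1 : C| = 1 by rewrite normrN1.
have BP i u : B u (row i P) = 0.
  have Lw' := L_refl (LP i) Lw m11.
  (* Only the coordinate along [row i P] changes, and only in sign. *)
  have w'P j : dot (w *m refl (row i P) (-1)) (row j P) != 0.
    rewrite mul_refl dotDl dotZl dot_row //; have [<-|_] := eqVneq i j.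
      have -> : dot w (row i P) + (-1 - 1) * dot w (row i P) * 1
              = - dot w (row i P) by ring.
      by rewrite oppr_eq0.
    by rewrite mulr0 addr0.
  have := B0r Lw' w'P u.
  rewrite mul_refl BDr BZr (B0r Lw wP) add0r => /eqP.
  rewrite mulf_eq0 => /orP [|/eqP //].
  rewrite conjC_eq0 mulf_eq0 (negbTE (wP i)) orbF.
  by rewrite -opprD oppr_eq0 -(natrD _ 1 1) pnatr_eq0.
have B0 u v : B u v = 0.
  rewrite (row_expansion v Pu); elim/big_rec: _ => [|i v' _ Bv].
    by rewrite /B !dot0r !mulr0 subrr.
  by rewrite BDr BZr Bv BP mulr0 addr0.
have xE : x = dot y x *: y.
  apply/eqP; rewrite -subr_eq0 -dot_eq0; set v := x - _.
  rewrite {1}/v -scaleNr dotDl dotZl mulNr.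
  by have := B0 y v; rewrite /B y1 mul1r => ->.
have c0 : 0 <= dot x y.
  rewrite (row_expansion x Pu) dot_suml; apply: sumr_ge0 => i _.
  by rewrite dotZl xy_ge0.
have c1 : dot y x = 1.
  have cE : dot y x = dot x y by rewrite dotC geC0_conj.
  have /eqP : dot x y ^+ 2 = 1.
    by rewrite expr2 -cE -dotZl -xE.
  by rewrite cE sqrp_eq1 // => /eqP.
by rewrite xE c1 scale1r.
Qed.

End MaximalPoint.

Lemma unitary_spectral (V : 'M[C]_n) : V \is unitarymx ->
  exists (P : 'M[C]_n) (d : 'rV[C]_n),
    [/\ P \is unitarymx, forall i, `|d 0 i| = 1 & V = P^t* *m diag_mx d *m P].
Proof.
move=> Vu; have Vn : V \is normalmx.
  by apply/normalmxP; rewrite (unitarymxP Vu) unitarymx_trC.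
have /orthomx_spectralP VE := Vn.
set P := spectralmx V in VE; set d := spectral_diag V in VE.
have Pu : P \is unitarymx by exact: spectral_unitarymx.
have PP := unitarymxP Pu; rewrite (invmx_unitary Pu) in VE.
exists P, d; split=> // i.
have Du : diag_mx d \is unitarymx.
  have -> : diag_mx d = P *m V *m P^t*.
    by rewrite VE !mulmxA PP mul1mx -mulmxA PP mulmx1.
  by rewrite !mul_unitarymx // trmxC_unitary.
have : `|d 0 i| ^+ 2 = 1.
  have := dot_row i i Du; rewrite eqxx row_diag_mx dotZl dotZr mulrA -normCK.
  by rewrite -row1 dot_row ?eqxx ?mulr1 //; apply/unitarymxP;
    rewrite trmx1 map_mx1 mulmx1.
by move/eqP; rewrite sqrp_eq1 ?normr_ge0 // => /eqP.
Qed.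

(** A unitary [V] is the product of the reflections along its eigenvectors with its eigenvalues as
    parameters; [D k] is the product of the first [k] of them. *)
Lemma unitary_refl_ind (G : 'M[C]_n -> Prop) :
  G 1%:M -> (forall A B, G A -> G B -> G (A *m B)) ->
  (forall a z, dot a a = 1 -> `|z| = 1 -> G (refl a z)) ->
  forall V, V \is unitarymx -> G V.
Proof.
move=> G1 GM Gr _ /unitary_spectral [P [d [Pu d1 ->]]].
have PP := unitarymxP Pu; have PtP := unitarymx_trC Pu.
pose D k := P^t* *m diag_mx (\row_j (if (j < k)%N then d 0 j else 1)) *m P.
have GD k : (k <= n)%N -> G (D k).
  elim: k => [_|k IH kn].
    suff -> : D 0 = 1%:M by [].
    rewrite /D (_ : diag_mx _ = 1%:M) ?mulmx1 //.
    by rewrite -diag_const_mx; congr diag_mx; apply/rowP => j; rewrite !mxE.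
  have -> : D k.+1 = D k *m refl (row (Ordinal kn) P) (d 0 (Ordinal kn)).
    rewrite refl_row // /D !mulmxA; congr (_ *m _).
    rewrite -[_ *m P *m P^t*]mulmxA PP mulmx1 -mulmxA; congr (_ *m _).
    rewrite mulmx_diag; congr diag_mx; apply/rowP => j; rewrite !mxE ltnS.
    have [->|jk] := eqVneq j (Ordinal kn); first by rewrite /= leqnn ltnn mul1r.
    by rewrite mulr1 leq_eqVlt -(inj_eq val_inj) /= in jk *; rewrite (negbTE jk).
  apply: GM; first by apply: IH; exact: ltnW.
  by apply: Gr; rewrite ?dot_row ?eqxx.
have := GD n (leqnn n); rewrite /D.
suff -> : (\row_j (if (j < n)%N then d 0 j else 1)) = d by [].
by apply/rowP => j; rewrite mxE ltn_ord.
Qed.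

End Reflections.

(** * Generation of U(n) by reflections *)

Section ComplexTopology.
Variable R : realType.
Local Notation C := R[i].

Lemma continuous_mx (T : topologicalType) m n (f : T -> 'M[C]_(m, n)) :
  (forall i j, continuous (fun t => f t i j)) -> continuous f.
Proof.
move=> cf x A [B nB BA].
have : \forall t \near x, forall i j, B i j (f t i j).
  apply: filter_forall => i; apply: filter_forall => j.
  exact: cf (nB i j).
by apply: filterS => t Bt; apply: BA.
Qed.

Lemma continuous_Re : continuous (@complex.Re R).
Proof.
move=> z A /nbhs_ballP[e /= e0 eA].
exists e%:C%C => /= [|t /=]; first by rewrite ltcR.
move=> zt; apply: eA; rewrite /ball /= -ltcR; apply: le_lt_trans zt.
by rewrite -raddfB; exact: normc_ge_Re.
Qed.

Lemma continuous_real_complex : continuous (fun x : R => x%:C%C : C).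
Proof.
move=> x; apply/cvgrPdist_lt => e; rewrite ltcE => /andP[/eqP ei e0].
exists (complex.Re e) => //= t h.
rewrite -rmorphB /= normc_def /= expr0n addr0 sqrtr_sqr.
by rewrite ltcE /= ei eqxx.
Qed.

Lemma continuous_conj : continuous (fun z : C => z^*).
Proof.
move=> z A [e e0 eA]; exists e => // t zt; apply: eA.
by rewrite /= -rmorphB /= norm_conjC.
Qed.

Lemma continuous_addc (T : topologicalType) (f g : T -> C) :
  continuous f -> continuous g -> continuous (fun x => f x + g x).
Proof. by move=> cf cg x; apply: cvgD; [exact: cf|exact: cg]. Qed.

Lemma continuous_mulc (T : topologicalType) (f g : T -> C) :
  continuous f -> continuous g -> continuous (fun x => f x * g x).
Proof. by move=> cf cg x; apply: cvgM; [exact: cf|exact: cg]. Qed.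

Lemma continuous_bigsum (T : topologicalType) (I : Type) (r : seq I)
    (P : pred I) (f : I -> T -> C) :
  (forall i, continuous (f i)) -> continuous (fun x => \sum_(i <- r | P i) f i x).
Proof.
move=> cf; elim: r => [|i r IH].
  by under eq_fun do rewrite big_nil; exact: cst_continuous.
under eq_fun do rewrite big_cons.
case: (P i); last exact: IH.
exact: (@continuous_addc _ _ _ (cf i) IH).
Qed.

Lemma continuous_entry (T : topologicalType) m n (f : T -> 'M[C]_(m, n)) i j :
  continuous f -> continuous (fun x => f x i j).
Proof.
move=> cf x.
exact: (continuous_comp (cf x) (@coord_continuous _ _ _ i j (f x))).
Qed.

Lemma continuous_conj_comp (T : topologicalType) (f : T -> C) :
  continuous f -> continuous (fun x => (f x)^*).
Proof. by move=> cf x; exact: (continuous_comp (cf x) (@continuous_conj (f x))). Qed.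

Lemma continuous_mulmx (T : topologicalType) m n p
    (f : T -> 'M[C]_(m, n)) (g : T -> 'M[C]_(n, p)) :
  continuous f -> continuous g -> continuous (fun x => f x *m g x).
Proof.
move=> cf cg; apply: continuous_mx => i j.
under eq_fun do rewrite mxE.
apply: continuous_bigsum => k; apply: continuous_mulc.
  exact: continuous_entry.
exact: continuous_entry.
Qed.

Lemma continuous_refl n (z : C) : continuous (fun a : 'rV[C]_n => refl a z).
Proof.
apply: continuous_mx => i j; under eq_fun do rewrite !mxE big_ord1 !mxE.
apply: continuous_addc; first exact: cst_continuous.
apply: continuous_mulc; first exact: cst_continuous.
apply: continuous_mulc; last exact: coord_continuous.
apply: continuous_conj_comp; exact: coord_continuous.
Qed.

Lemma continuous_dot n (y : 'rV[C]_n) : continuous (fun x => dot x y).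
Proof.
under eq_fun do rewrite dotE.
apply: continuous_bigsum => i; apply: continuous_mulc; last exact: cst_continuous.
exact: coord_continuous.
Qed.

Lemma continuous_dot_diag n : continuous (fun x : 'rV[C]_n => dot x x).
Proof.
under eq_fun do rewrite dotE.
apply: continuous_bigsum => i; apply: continuous_mulc; first exact: coord_continuous.
apply: continuous_conj_comp; exact: coord_continuous.
Qed.

Lemma closed_fiber (T : topologicalType) (f : T -> C) (c : C) :
  continuous f -> closed [set x | f x = c].
Proof.
move=> cf; rewrite (_ : [set x | _] = f @^-1` [set c]) //.
apply: closed_comp => [x _|]; first exact: cf.
by apply: accessible_closed_set1; apply: hausdorff_accessible;
  exact: norm_hausdorff.
Qed.

Definition unit_square : set C :=
  [set z | `|complex.Re z| <= 1 /\ `|complex.Im z| <= 1].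

Lemma compact_unit_square : compact unit_square.
Proof.
pose f (p : R * R) : C := p.1%:C%C + 'i * p.2%:C%C.
have -> : unit_square = f @` (`[(-1), 1] `*` `[(-1), 1]).
  apply/seteqP; split => [z [zr zi]|z [[a b] [ha hb] <-]].
    exists (complex.Re z, complex.Im z); last by rewrite /f -complexiE -complexE.
    by split; rewrite /= in_itv /= -ler_norml.
  rewrite /= !in_itv /= -!ler_norml in ha hb.
  by rewrite /f -complexiE; split;
    rewrite /= ?mul0r ?mul1r ?mulr0 ?subr0 ?addr0 ?add0r.
apply: continuous_compact; last by apply: compact_setX; exact: segment_compact.
apply: continuous_subspaceT.
apply: continuous_addc.
  move=> p; apply: (@continuous_comp _ _ _ fst); first exact: cvg_fst.
  exact: continuous_real_complex.
apply: continuous_mulc; first exact: cst_continuous.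
move=> p; apply: (@continuous_comp _ _ _ snd); first exact: cvg_snd.
exact: continuous_real_complex.
Qed.

Lemma compact_sphere_subset n (L : set 'rV[C]_n) :
  closed L -> (forall x, L x -> dot x x = 1) -> compact L.
Proof.
move=> cL L1; apply: (subclosed_compact cL).
  exact: (rV_compact (fun=> compact_unit_square)).
move=> x Lx i; have /eqP := L1 x Lx; rewrite dotE (bigD1 i) //= -normCK => /eqP x1.
have {}x1 : `|x 0 i| <= 1.
  rewrite -(@expr_le1 _ 2) // -x1 lerDl; apply: sumr_ge0 => j _.
  by rewrite -normCK exprn_ge0.
have nI : `|complex.Im (x 0 i)|%:C%C <= `|x 0 i|.
  have := normc_ge_Re (x 0 i * 'i%C); rewrite ReiNIm normrN normrM.
  by rewrite complexiE normCi mulr1.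
split; rewrite -lecR; apply: le_trans x1 => //; exact: normc_ge_Re.
Qed.

(** Serves twice: with the standard basis, for the density of reflection words, and with the
    eigenbasis of a generic [U]. The vector [w], orthogonal to no row of [P], links the basis
    directions. *)
Lemma reflections_generate n (G : set 'M[C]_n) (P : 'M[C]_n) (w : 'rV[C]_n) :
  closed G -> G 1%:M -> (forall A B, G A -> G B -> G (A *m B)) ->
  P \is unitarymx -> dot w w = 1 -> (forall i, dot w (row i P) != 0) ->
  (forall i z, `|z| = 1 -> G (refl (row i P) z)) ->
  (forall z, `|z| = 1 -> G (refl w z)) ->
  forall V, V \is unitarymx -> G V.
Proof.
move=> cG G1 GM Pu w1 wP GP Gw.
pose L : set 'rV[C]_n :=
  [set a | dot a a = 1 /\ forall z, `|z| = 1 -> G (refl a z)].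
have L_refl a b z : L a -> L b -> `|z| = 1 -> L (b *m refl a z).
  move=> [a1 Ga] [b1 Gb] z1; have au := refl_unitary a1 z1.
  split=> [|y y1]; first by rewrite dot_unitary.
  (* Conjugating the reflection along [b] by the one along [a] gives the reflection along the moved
     vector. *)
  rewrite -refl_conj // refl_tr; apply: (GM); last exact: Ga.
  by apply: (GM); [apply: (Ga); rewrite norm_conjC|exact: Gb].
have LP i : L (row i P) by split=> [|z]; [rewrite dot_row ?eqxx|exact: GP].
have Lw : L w by [].
have cL : compact L.
  apply: compact_sphere_subset; last by move=> x [].
  have -> : L = [set a | dot a a = 1] `&`
      \bigcap_(z in [set z | `|z| = 1]) ((fun a => refl a z) @^-1` G).
    by apply/seteqP; split => a [a1 Ga]; split=> // z z1; exact: Ga.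
  apply: closedI; first by apply: closed_fiber; exact: continuous_dot_diag.
  apply: closed_bigI => z z1; apply: closed_comp => // x _.
  exact: continuous_refl.
suff sphere y : dot y y = 1 -> L y.
  by apply: unitary_refl_ind => // a z a1 z1; exact: (sphere a a1).2.
move=> y1.
have [x xL xmax] : exists2 x, x \in L & forall t, t \in L ->
    complex.Re (dot t y) <= complex.Re (dot x y).
  apply: (compact_EVT_max (f := fun t => complex.Re (dot t y))) => //.
    by exists w.
  apply: continuous_subspaceT => t.
  apply: (@continuous_comp _ _ _ (fun t => dot t y)); first exact: continuous_dot.
  exact: continuous_Re.
have Lx := set_mem xL.
suff <- : x = y by [].
apply: (positive_products_eq Pu LP Lw wP L_refl) => //; last exact: Lx.1.
move=> a La; set c := dot x a * dot a y.
(* Replacing [x] by [x *m refl a z] adds [(z - 1) * c] to [dot x y], so maximality applies. *)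
have step z : `|z| = 1 -> complex.Re (z * c) <= complex.Re c.
  move=> z1; have := xmax _ (mem_set (L_refl _ _ _ La Lx z1)).
  rewrite mul_refl dotDl dotZl raddfD /= -[leRHS]addr0 lerD2l -mulrA -/c.
  by rewrite mulrBl mul1r raddfB /= subr_le0.
have [->//|c0] := eqVneq c 0.
have nc : `|c| != 0 by rewrite normr_eq0.
(* This [z] turns [c] onto the positive real axis: [|c| <= Re c], so [c] is real and nonnegative. *)
have := step (c^* / `|c|); rewrite normrM norm_conjC normfV normr_id divff //.
rewrite mulrAC [c^* * c]mulrC -normCK expr2 mulfK // => /(_ erefl) h.
have h1 : complex.Re c = complex.Re `|c|.
  apply/eqP; rewrite eq_le h andbT; have := normc_ge_Re c.
  rewrite lecE /= => /andP[_]; apply: le_trans; exact: ler_norm.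
have h2 : complex.Im c = 0.
  have := add_Re2_Im2 c; rewrite h1 => h3; apply/eqP.
  rewrite -sqrf_eq0; apply/eqP/complexI.
  have cE : (complex.Re `|c|)%:C%C = `|c| by rewrite RRe_real // normr_real.
  move: h3; rewrite rmorphD !rmorphXn /= cE => h3.
  by apply: (addrI (`|c| ^+ 2)); rewrite h3 addr0.
rewrite lecE /= h2 eqxx /= h1.
by have := normr_ge0 c; rewrite lecE /= => /andP[].
Qed.

End ComplexTopology.

(** * Kronecker's theorem *)

Section Kronecker.
Variable R : realType.
Local Notation C := R[i].

Lemma archi_le0 (x y : R) : (forall k : nat, k%:R * x <= y) -> x <= 0.
Proof.
move=> xy; rewrite leNgt; apply/negP => x0.
have := archi_boundP (normr_ge0 (y / x)); set k := Num.bound _ => yk.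
have := xy k; rewrite -ler_pdivlMr // leNgt => /negP; apply.
exact: le_lt_trans (ler_norm _) yk.
Qed.

(** Were all these quantities at least 1, Bernoulli's inequality [x (m + 1) <= (1 + x)^m], for an
    [x > 0] with [(1 + x)^(d + 1) r <= 1], would give [(m + 1) x^(d + 1) <= 1] for all [m]. *)
Lemma expr_gt_poly (r : R) (d : nat) : 0 <= r < 1 ->
  exists m : nat, (m.+1)%:R ^+ d * r ^+ m < 1.
Proof.
move=> /andP[r0 r1]; apply: contrapT => noex.
have {}noex m : 1 <= (m.+1)%:R ^+ d * r ^+ m.
  by rewrite leNgt; apply/negP => h; apply: noex; exists m.
pose x := (1 - r) / 2 ^+ d.+1.
have p0 k : 0 < 2 ^+ k :> R by rewrite exprn_gt0.
have x0 : 0 < x by rewrite divr_gt0 ?subr_gt0.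
have x1 : x <= 1.
  rewrite ler_pdivrMr // mul1r (le_trans (y := 1)) ?gerBl //.
  by rewrite exprn_ege1 // ler1n.
(* Convexity: on [[0, 1]] the power lies below its chord. *)
have bern k : (1 + x) ^+ k <= 1 + (2 ^+ k - 1) * x.
  elim: k => [|k IH]; first by rewrite !expr0 subrr mul0r addr0.
  rewrite exprS; apply: le_trans (ler_wpM2l _ IH) _.
    by rewrite addr_ge0 // ltW.
  rewrite -subr_ge0 (_ : _ - _ = (2 ^+ k - 1) * (x * (1 - x))).
    by rewrite !mulr_ge0 ?subr_ge0 ?exprn_ege1 ?ler1n // ltW.
  rewrite exprS; ring.
have xr : (1 + x) ^+ d.+1 * r <= 1.
  apply: le_trans (ler_wpM2r r0 (bern _)) _.
  have -> : (1 + (2 ^+ d.+1 - 1) * x) * r = (1 - (1 - r) ^+ 2) - x * r.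
    have e : 2 ^+ d.+1 * x = 1 - r by rewrite /x mulrC divfK // gt_eqF.
    rewrite mulrBl e; ring.
  rewrite -addrA gerDl -opprD oppr_le0.
  by rewrite addr_ge0 ?sqr_ge0 // mulr_ge0 // ltW.
have bern' m : x * m.+1%:R <= (1 + x) ^+ m.
  apply: (@le_trans _ _ (1 + m%:R * x)).
    by rewrite -natr1 mulrDr mulr1 addrC [x * _]mulrC lerD2r.
  elim: m => [|m IH]; first by rewrite mul0r addr0 expr0.
  rewrite exprS; apply: le_trans (ler_wpM2l _ IH); last first.
    by rewrite addr_ge0 // ltW.
  rewrite -subr_ge0 -natr1 (_ : _ - _ = m%:R * (x * x)); last by ring.
  by apply: mulr_ge0; rewrite ?ler0n // mulr_ge0 // ltW.
suff : x ^+ d.+1 <= 0 by rewrite leNgt exprn_gt0.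
apply: (@archi_le0 _ 1) => m.
apply: (@le_trans _ _ (m.+1%:R * x ^+ d.+1)).
  by rewrite ler_wpM2r ?ler_nat // exprn_ge0 // ltW.
have M0 : 0 < m.+1%:R ^+ d :> R by rewrite exprn_gt0.
rewrite -(ler_pM2l M0) mulr1 mulrA -exprSr -exprMn mulrC.
apply: (@le_trans _ _ (((1 + x) ^+ m) ^+ d.+1)).
  apply: lerXn2r => //.
  - by rewrite ?nnegrE mulr_ge0 // ltW.
  - by rewrite nnegrE exprn_ge0 // addr_ge0 // ltW.
rewrite -exprM mulnC exprM.
have := ler_wpM2l (exprn_ge0 m (exprn_ge0 d.+1 (_ : 0 <= 1 + x))) (noex m).
rewrite mulr1 => h; apply: le_trans (h _) _; first by rewrite addr_ge0 // ltW.
rewrite mulrCA -exprMn; apply: ler_piMr; first exact: ltW.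
apply: exprn_ile1 => //.
by rewrite mulr_ge0 // exprn_ge0 // addr_ge0 // ltW.
Qed.

(* Averaging [P n / chi j ^+ n] over [n < N] isolates [c j] up to [O(1/N)]. *)
Lemma coef_le_sup (J : finType) (c chi : J -> C) (b : C) :
  (forall j, `|chi j| = 1) -> injective chi ->
  (forall n, `|\sum_j c j * chi j ^+ n| <= b) -> forall j, `|c j| <= b.
Proof.
move=> chi1 chiI Pb j.
have b0 : 0 <= b := le_trans (normr_ge0 _) (Pb 0%N).
pose u l := chi l * (chi j)^*.
have u1 l : `|u l| = 1 by rewrite normrM norm_conjC !chi1 mulr1.
have uj : u j = 1 by rewrite /u -normCK chi1 expr1n.
have un l : l != j -> u l - 1 != 0.
  apply: contraNneq => /eqP; rewrite subr_eq0 => /eqP ul.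
  apply/eqP; apply: chiI; rewrite -[LHS]mulr1 -(expr1n _ 2) -(chi1 j) normCKC.
  by rewrite mulrA -/(u l) ul mul1r.
pose K := \sum_(l | l != j) `|c l| * (2 / `|u l - 1|).
have K0 : 0 <= K.
  by apply: sumr_ge0 => l _; rewrite mulr_ge0 // divr_ge0.
(* A geometric sum with ratio [u l != 1] of modulus one stays bounded in [N]; only the term [l = j]
   grows. *)
have geo N l : l != j -> `|\sum_(n < N) u l ^+ n| <= 2 / `|u l - 1|.
  move=> lj; have := un l lj; rewrite -normr_gt0 => n0.
  rewrite ler_pdivlMr // mulrC -normrM -subrX1.
  by apply: le_trans (ler_normB _ _) _; rewrite normrX u1 expr1n normr1.
have main N : N%:R * (`|c j| - b) <= K.
  rewrite mulrBr lerBlDl.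
  have e : \sum_(n < N) (\sum_l c l * chi l ^+ n) * (chi j)^* ^+ n =
      c j *+ N + \sum_(l | l != j) c l * \sum_(n < N) u l ^+ n.
    transitivity (\sum_l c l * \sum_(n < N) u l ^+ n).
      under eq_bigr do rewrite mulr_suml.
      rewrite exchange_big; apply: eq_bigr => l _; rewrite mulr_sumr.
      by apply: eq_bigr => n _; rewrite -mulrA -exprMn.
    rewrite (bigD1 j) //=; congr (_ + _); rewrite uj.
    under eq_bigr do rewrite expr1n.
    by rewrite sumr_const card_ord mulr_natr.
  have -> : N%:R * `|c j| = `|c j *+ N| by rewrite normrMn mulr_natl.
  have -> : c j *+ N = \sum_(n < N) (\sum_l c l * chi l ^+ n) * (chi j)^* ^+ n
      - \sum_(l | l != j) c l * \sum_(n < N) u l ^+ n by rewrite e addrK.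
  apply: le_trans (ler_normB _ _) _; apply: lerD.
    apply: le_trans (ler_norm_sum _ _ _) _.
    rewrite mulr_natl -[X in _ *+ X](card_ord N) -sumr_const.
    apply: ler_sum => n _; rewrite normrM normrX norm_conjC chi1 expr1n mulr1.
    exact: (Pb n).
  apply: le_trans (ler_norm_sum _ _ _) _; apply: ler_sum => l lj.
  by rewrite normrM ler_wpM2l // geo.
have Kr := ger0_real K0.
have cr : `|c j| - b \is Num.real by rewrite rpredB // ger0_real.
rewrite -subr_le0 -(RRe_real cr) lecR; apply: (@archi_le0 _ (complex.Re K)) => N.
have := main N; rewrite -(RRe_real cr) -(RRe_real Kr).
by rewrite -(rmorph_nat (real_complex R)) -rmorphM lecR.
Qed.

(** Parallelogram law: [|1 + u|^2 + |u - 1|^2 = 4]. *)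
Lemma norm_add1_le (u e : C) :
  `|u| = 1 -> 0 <= e -> e <= `|u - 1| -> `|1 + u| <= sqrtC (4 - e ^+ 2).
Proof.
move=> u1 e0 eu.
have h : `|1 + u| ^+ 2 = 4 - `|u - 1| ^+ 2.
  apply/eqP; rewrite eq_sym subr_eq !normCK !rmorphD rmorphN /= conjC1.
  have -> : (1 + u) * (1 + u^*) + (u - 1) * (u^* - 1) = 2 + 2 * (u * u^*).
    by ring.
  by rewrite -normCK u1 expr1n; apply/eqP; ring.
rewrite -[leLHS]sqrCK ?normr_ge0 // h.
have b4 : 0 <= 4 - `|u - 1| ^+ 2 by rewrite -h exprn_ge0.
have le4 : 4 - `|u - 1| ^+ 2 <= 4 - e ^+ 2.
  by rewrite lerD2l lerN2 lerXn2r // nnegrE.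
by rewrite ler_sqrtC // nnegrE; exact: le_trans le4.
Qed.

(* The coefficients of [P = \prod_i (1 + x_i / tau_i) ^+ m] are bounded by the
   supremum of [|P|] over the orbit of [lam], and their moduli add up to
   [2 ^ (m d)].  If the orbit avoids a neighbourhood of [tau], that supremum is
   exponentially smaller than [2 ^ (m d)], whereas [P] has only [(m + 1) ^ d]
   terms. *)
Lemma kronecker d (lam tau : 'I_d -> C) (e : C) :
  (forall i, `|lam i| = 1) -> (forall i, `|tau i| = 1) ->
  (forall a b : 'I_d -> nat,
     \prod_i lam i ^+ a i = \prod_i lam i ^+ b i -> a =1 b) ->
  0 < e -> exists n : nat, forall i, `|lam i ^+ n - tau i| < e.
Proof.
move=> lam1 tau1 indep e0; apply: contrapT => noex.
have far n : exists i, e <= `|lam i ^+ n - tau i|.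
  apply: contrapT => nofar; apply: noex; exists n => i.
  rewrite real_ltNge ?normr_real ?gtr0_real //; apply/negP => ei.
  by apply: nofar; exists i.
(* Two numbers of modulus one are at distance at most 2, so the failure at [n = 0] already bounds
   [e]. *)
have e2 : e ^+ 2 <= 4.
  have [i ei] := far 0%N.
  rewrite (_ : 4 = 2 ^+ 2); last by rewrite -natrX.
  rewrite lerXn2r ?nnegrE ?(ltW e0) //; apply: le_trans ei _.
  by apply: le_trans (ler_normB _ _) _; rewrite expr0 normr1 tau1.
(* If [u] has modulus one and [|u - 1| >= e], then [|1 + u| <= 2 * rho]. *)
pose rho : C := sqrtC (4 - e ^+ 2) / 2.
have rho0 : 0 <= rho by rewrite divr_ge0 // sqrtC_ge0 subr_ge0.
have rho1 : rho < 1.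
  rewrite ltr_pdivrMr // mul1r -[ltRHS](@sqrCK _ 2) //.
  rewrite ltr_sqrtC ?nnegrE ?subr_ge0 // -natrX.
  by rewrite gtrBl exprn_gt0.
have rhoE := RRe_real (ger0_real rho0).
have [m] : exists m, m.+1%:R ^+ d * complex.Re rho ^+ m < 1.
  by apply: expr_gt_poly; rewrite -!ltcR -!lecR rhoE rho0 rho1.
rewrite -ltcR rmorphM !rmorphXn /= rhoE rmorph_nat => hm.
pose J := {ffun 'I_d -> 'I_m.+1}.
pose c (j : J) := \prod_i ((tau i)^* ^+ j i *+ 'C(m, j i)).
pose chi (j : J) := \prod_i lam i ^+ j i.
pose b : C := rho ^+ m * \prod_(i < d) 2 ^+ m.
have chi1 j : `|chi j| = 1.
  rewrite normr_prod big1 // => i _; by rewrite normrX lam1 expr1n.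
(* Multiplicative independence: distinct monomials take distinct values at [lam]. *)
have chiI : injective chi.
  move=> j k /indep jk; apply/ffunP => i; apply/val_inj; exact: jk.
have sumE n : \sum_j c j * chi j ^+ n
    = \prod_i (1 + lam i ^+ n * (tau i)^*) ^+ m.
  under [RHS]eq_bigr do rewrite exprDn.
  rewrite bigA_distr_bigA; apply: eq_bigr => j _.
  rewrite -prodrXl -big_split; apply: eq_bigr => i _ /=.
  by rewrite expr1n mul1r mulrnAl exprMn mulrC -!exprM mulnC.
have Pb n : `|\sum_j c j * chi j ^+ n| <= b.
  (* The far coordinate contributes at most [(2 * rho)^m], every other one at most [2^m]. *)
  have [i ei] := far n.
  rewrite sumE normr_prod (bigD1 i) //= /b [in leRHS](bigD1 i) //= mulrA.
  have ui k : `|lam k ^+ n * (tau k)^*| = 1.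
    by rewrite normrM normrX norm_conjC lam1 tau1 expr1n mulr1.
  apply: ler_pM => //; first exact: prodr_ge0.
    have rho2 : 0 <= rho * 2 by exact: mulr_ge0.
    rewrite normrX -exprMn; apply: lerXn2r; rewrite ?nnegrE // /rho.
    rewrite divfK ?pnatr_eq0 //; apply: norm_add1_le => //; first exact: ltW.
    rewrite (_ : _ - 1 = (lam i ^+ n - tau i) * (tau i)^*).
      by rewrite normrM norm_conjC tau1 mulr1.
    by rewrite mulrBl -normCK tau1 expr1n.
  apply: ler_prod => k _; rewrite normr_ge0 normrX lerXn2r ?nnegrE //.
  by apply: le_trans (ler_normD _ _) _; rewrite normr1 ui.
have p2 : 0 < \prod_(i < d) 2 ^+ m :> C.
  by apply: prodr_gt0 => i _; rewrite exprn_gt0.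
have : \sum_j `|c j| <= \sum_(j : J) b.
  by apply: ler_sum => j _; exact: coef_le_sup chi1 chiI Pb j.
have -> : \sum_j `|c j| = \prod_(i < d) 2 ^+ m.
  have e11 : (2 : C) = 1 + 1 by [].
  under [RHS]eq_bigr do rewrite e11 exprDn.
  rewrite bigA_distr_bigA; apply: eq_bigr => j _; rewrite normr_prod.
  by apply: eq_bigr => i _; rewrite normrMn normrX norm_conjC tau1 !expr1n mulr1.
rewrite sumr_const card_ffun !card_ord -[b *+ _]mulr_natl natrX /b mulrA.
rewrite -[leLHS]mul1r ler_pM2r // => h.
by have := le_lt_trans h hm; rewrite ltxx.
Qed.

End Kronecker.

(** * Haar-null sets *)

Section PolynomialNullSets.
Variable R : realType.
Local Notation C := R[i].

(** Polynomiality is recorded only along complex lines, which suffices for counting roots; [D]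
    bounds the degree plus one, uniformly over the lines. *)
Definition pencil_poly n D (f : 'M[C]_n -> C) :=
  continuous f /\ forall A B, exists p : {poly C},
    (size p <= D)%N /\ forall z, f (A + z *: B) = p.[z].

Definition polyfun n (f : 'M[C]_n -> C) := exists D, pencil_poly D f.

Lemma polyfun_cst n c : polyfun (fun _ : 'M[C]_n => c).
Proof.
exists 1%N; split=> [|A B]; first exact: cst_continuous.
by exists c%:P; split=> [|z]; rewrite ?size_polyC_leq1 ?hornerC.
Qed.

Lemma polyfun_entry n i j : polyfun (fun X : 'M[C]_n => X i j).
Proof.
exists 2; split=> [|A B]; first exact: coord_continuous.
exists ((A i j)%:P + B i j *: 'X); split=> [|z].
  rewrite (leq_trans (size_polyD _ _)) // geq_max.
  rewrite (leq_trans (size_polyC_leq1 _)) //.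
  by rewrite (leq_trans (size_scale_leq _ _)) // size_polyX.
by rewrite hornerD hornerC hornerZ hornerX !mxE mulrC.
Qed.

Lemma polyfunD n (f g : 'M[C]_n -> C) :
  polyfun f -> polyfun g -> polyfun (fun X => f X + g X).
Proof.
move=> [D [cf fp]] [E [cg gp]]; exists (D + E)%N; split=> [|A B].
  exact: (continuous_addc cf cg).
have [p [ps pE]] := fp A B; have [q [qs qE]] := gp A B.
exists (p + q); split=> [|z]; last by rewrite hornerD pE qE.
rewrite (leq_trans (size_polyD _ _)) // geq_max.
by rewrite (leq_trans ps (leq_addr _ _)) (leq_trans qs (leq_addl _ _)).
Qed.

Lemma polyfunM n (f g : 'M[C]_n -> C) :
  polyfun f -> polyfun g -> polyfun (fun X => f X * g X).
Proof.
move=> [D [cf fp]] [E [cg gp]]; exists (D + E)%N; split=> [|A B].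
  exact: (continuous_mulc cf cg).
have [p [ps pE]] := fp A B; have [q [qs qE]] := gp A B.
exists (p * q); split=> [|z]; last by rewrite hornerM pE qE.
rewrite (leq_trans (size_polyMleq _ _)) // (leq_trans (leq_pred _)) //.
exact: leq_add.
Qed.

Lemma polyfun_sum n (I : Type) (r : seq I) (P : pred I) (f : I -> 'M[C]_n -> C) :
  (forall i, polyfun (f i)) -> polyfun (fun X => \sum_(i <- r | P i) f i X).
Proof.
move=> pf; elim: r => [|i r IH].
  by under eq_fun do rewrite big_nil; exact: polyfun_cst.
under eq_fun do rewrite big_cons; case: (P i); last exact: IH.
exact: (polyfunD (pf i) IH).
Qed.

Lemma polyfun_prod n (I : Type) (r : seq I) (P : pred I) (f : I -> 'M[C]_n -> C) :
  (forall i, polyfun (f i)) -> polyfun (fun X => \prod_(i <- r | P i) f i X).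
Proof.
move=> pf; elim: r => [|i r IH].
  by under eq_fun do rewrite big_nil; exact: polyfun_cst.
under eq_fun do rewrite big_cons; case: (P i); last exact: IH.
exact: (polyfunM (pf i) IH).
Qed.

Lemma polyfunX n (f : 'M[C]_n -> C) k : polyfun f -> polyfun (fun X => f X ^+ k).
Proof.
move=> pf; elim: k => [|k IH]; first exact: polyfun_cst.
under eq_fun do rewrite exprS; exact: (polyfunM pf IH).
Qed.

(* The Cayley transform [(1 + ik) / (1 - ik)]. *)
Definition unit_point (k : nat) : C := 2 / (1 - 'i * k%:R) - 1.

Lemma unit_point_den k : 1 - 'i * k%:R != 0 :> C.
Proof.
apply/eqP => /(congr1 (fun z => z + z^*)); rewrite rmorphB rmorphM /= conjC1.
rewrite conjCi conjC_nat conjC0 addr0 => /eqP; rewrite mulNr opprK addrACA.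
by rewrite addNr addr0 -(natrD _ 1 1) pnatr_eq0.
Qed.

Lemma norm_unit_point k : `|unit_point k| = 1.
Proof.
have d0 := unit_point_den k.
have -> : unit_point k = (1 - 'i * k%:R)^* / (1 - 'i * k%:R).
  apply: (mulIf d0); rewrite divfK // /unit_point mulrBl divfK //.
  rewrite rmorphB rmorphM /= conjC1 conjCi conjC_nat; ring.
by rewrite normrM norm_conjC normfV divff // normr_eq0.
Qed.

Lemma unit_point_inj : injective unit_point.
Proof.
move=> j k /addIr /(mulfI _) jk.
have n2 : (2 : C) != 0 by rewrite pnatr_eq0.
have := congr1 GRing.inv (jk n2); rewrite !invrK.
move=> /addrI /oppr_inj /(mulfI (neq0Ci _)) /eqP.
by rewrite eqr_nat => /eqP.
Qed.

(** * Measure of the exceptional sets *)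

Section Haar.
Variable mu : probability (borelU4 R) R.
Hypothesis mu_haar : haar mu.

Definition zeros (f : 'M[C]_4 -> C) (S : set 'M[C]_4) : set (U4 R) :=
  [set U | forall g, S g -> f (g *m U4mx U) = 0].

Definition extend_refl (S : set 'M[C]_4) (a : 'rV[C]_4) : set 'M[C]_4 :=
  [set X | exists g z, [/\ S g, `|z| = 1 & X = g *m refl a z]].

Lemma closed_zeros f S : continuous f -> closed (zeros f S).
Proof.
move=> cf; have -> : zeros f S =
    \bigcap_(g in S) [set U | f (g *m U4mx U) = 0] by [].
apply: closed_bigI => g _; apply: closed_fiber => U.
have cU : continuous (fun U : U4 R => g *m U4mx U).
  apply: continuous_mulmx; first exact: cst_continuous.
  exact: initial_continuous.
exact: (continuous_comp (cU U) (cf _)).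
Qed.

Lemma measurable_closedU4 (A : set (borelU4 R)) :
  closed (A : set (U4 R)) -> measurable A.
Proof.
move=> cA; rewrite -[A]setCK; apply: measurableC.
by apply: sub_sigma_algebra; exact: closed_openC.
Qed.

(** If some [V k] lies in the set, there is a [g] in [S] for which [f (g *m refl a y *m U)] is a
    nonzero polynomial in [y]; it vanishes at [unit_point k] for every [V k] in the set. *)
Lemma count_zeros f D S a U : pencil_poly D f -> dot a a = 1 ->
  forall (N : nat) (V : nat -> U4 R),
  (forall k, U4mx (V k) = refl a (unit_point k) *m U4mx U) ->
  (\sum_(k < N) \1_(zeros f S `\` zeros f (extend_refl S a)) (V k) <= D%:R :> R).
Proof.
move=> [_ fp] a1 N V VE; set E := _ `\` _.
have -> : \sum_(k < N) \1_E (V k) = (#|[set k : 'I_N | V k \in E]%SET|)%:R :> R.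
  rewrite -sum1_card natr_sum [in RHS]big_mkcond /=; apply: eq_bigr => k _.
  by rewrite inE indicE; case: (V k \in E).
rewrite ler_nat; set I := [set k : 'I_N | V k \in E]%SET.
have [->|[k0]] := set_0Vmem I; first by rewrite cards0.
rewrite inE => /set_mem [_ /existsNP[h]] /not_implyP[[g [z [Sg z1 hE]]] fn0].
(* The pencil comes from writing [refl a y] as [(1 - a^* a) + y a^* a]. *)
have [p [ps pE]] := fp (g *m U4mx U - g *m (a^t* *m a) *m U4mx U)
                       (g *m (a^t* *m a) *m U4mx U).
have {}pE y : f (g *m refl a y *m U4mx U) = p.[y].
  rewrite -pE; congr f; rewrite /refl mulmxDr mulmx1 -scalemxAr mulmxDl -scalemxAl.
  by rewrite scalerBl scale1r addrCA addrC.
have p0 : p != 0.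
  apply: contra_notN fn0 => /eqP p0.
  by rewrite hE VE mulmxA -(mulmxA g) refl_mul // pE p0 horner0.
have := @max_poly_roots _ p [seq unit_point k | k : 'I_N in I] p0.
rewrite size_map -cardE => h1; apply: ltnW; apply: leq_trans ps; apply: h1.
  apply/allP => y /mapP[k]; rewrite mem_enum inE => /set_mem [Vk _] ->.
  by rewrite /root -pE -mulmxA -VE; apply/eqP; exact: Vk.
rewrite map_inj_uniq ?enum_uniq // => j k /unit_point_inj; exact: val_inj.
Qed.

(** Left invariance is stated for images; a preimage under translation by a reflection is the image
    under its inverse, which has parameter [z^*]. *)
Lemma refl_translate_measure (E : set (borelU4 R)) a z (V : U4 R -> U4 R) :
  dot a a = 1 -> `|z| = 1 -> measurable E ->
  (forall U, U4mx (V U) = refl a z *m U4mx U) -> mu (V @^-1` E) = mu E.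
Proof.
move=> a1 z1 mE VE.
have z1' : `|z^*| = 1 by rewrite norm_conjC.
pose W := mkU4 (refl_unitary a1 z1').
rewrite -(mu_haar W mE); congr (mu _).
apply/seteqP; split=> [U UE|_ [U UE <-]].
  exists (V U) => //; apply/val_inj; rewrite /= -/(U4mx _) VE mulmxA.
  by rewrite refl_mul // -normCKC z1 expr1n refl1 mul1mx.
rewrite /preimage /=; suff -> : V (U4mul W U) = U by [].
apply/val_inj; rewrite [LHS]VE /= mulmxA refl_mul //.
by rewrite -normCK z1 expr1n refl1 mul1mx.
Qed.

(** Integrating [count_zeros] gives [N * mu E <= D] for all [N], as the preimages of [E] all have
    the measure of [E]. *)
Lemma null_extend_refl f D S a : pencil_poly D f -> dot a a = 1 ->
  mu (zeros f S `\` zeros f (extend_refl S a)) = 0%E.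
Proof.
move=> fp a1; set E := _ `\` _.
have mE : measurable (E : set (borelU4 R)).
  by apply: measurableD; apply: measurable_closedU4; apply: closed_zeros; case: fp.
pose V k U := U4mul (mkU4 (refl_unitary a1 (norm_unit_point k))) U : U4 R.
have cV k : continuous (V k : U4 R -> U4 R).
  apply: continuous_comp_initial.
  apply: continuous_mulmx; first exact: cst_continuous.
  exact: initial_continuous.
have mV k : measurable (V k @^-1` E : set (borelU4 R)).
  rewrite (_ : _ @^-1` _ = V k @^-1` zeros f S `\`
      V k @^-1` zeros f (extend_refl S a)) //.
  apply: measurableD; apply: measurable_closedU4;
    by apply: closed_comp => [U _|]; [exact: cV|apply: closed_zeros; case: fp].
have muE : mu E = (fine (mu E))%:E by rewrite fineK // fin_num_measure.
have bound N : (N%:R%:E * mu E <= D%:R%:E)%E.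
  have -> : (N%:R%:E * mu E = \sum_(k < N) mu (V k @^-1` E))%E.
    have muV k : mu (V k @^-1` E) = mu E.
      exact: (refl_translate_measure a1 (norm_unit_point k) mE).
    under eq_bigr do rewrite muV.
    by rewrite muE sumEFin sumr_const card_ord -EFinM mulr_natl.
  have -> : (\sum_(k < N) mu (V k @^-1` E) =
      \sum_(k < N) \int[mu]_U (\1_(V k @^-1` E) U)%:E)%E.
    by apply: eq_bigr => k _; rewrite integral_indic // setIT.
  rewrite -ge0_integral_sum //; last first.
    by move=> k; exact/measurable_EFinP/measurable_indic.
  rewrite -[leRHS]mule1 -(probability_setT mu) -integral_cst //.
  apply: ge0_le_integral => //.
  - by move=> U _; apply: sume_ge0.
  - by apply: emeasurable_sum => k; exact/measurable_EFinP/measurable_indic.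
  - move=> U _; rewrite sumEFin lee_fin.
    exact: (@count_zeros f D S a U fp a1 N (fun k => V k U)).
rewrite muE; congr EFin; apply/eqP; rewrite eq_le fine_ge0 // andbT.
apply: (@archi_le0 _ _ D%:R) => N; rewrite -lee_fin EFinM -muE; exact: bound.
Qed.

(** The head of the list is the rightmost factor, so a product of words corresponds to the lists
    concatenated in reverse order. *)
Definition refl_words (K : Type) (d : K -> 'rV[C]_4) (ds : seq K) : set 'M[C]_4 :=
  foldr (fun k S => extend_refl S (d k)) [set 1%:M] ds.

Lemma refl_words_cat (K : Type) (d : K -> 'rV[C]_4) ds1 ds2 X Y :
  refl_words d ds1 X -> refl_words d ds2 Y -> refl_words d (ds2 ++ ds1) (X *m Y).
Proof.
move=> X1; elim: ds2 Y => [Y ->|k ds IH _ [Y [z [Yd z1 ->]]]].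
  by rewrite mulmx1.
by rewrite mulmxA; exists (X *m Y), z; split=> //; exact: IH.
Qed.

(** A point lost between the two zero sets is lost at one of finitely many extensions, each of which
    loses a null set. *)
Lemma negligible_refl_words f D (K : Type) (d : K -> 'rV[C]_4) ds :
  pencil_poly D f -> (forall k, dot (d k) (d k) = 1) ->
  mu.-negligible (zeros f [set 1%:M] `\` zeros f (refl_words d ds)).
Proof.
move=> fp d1; elim: ds => [|k ds IH].
  by rewrite /= setDv; exact: negligible_set0.
set A := refl_words d ds in IH *.
apply: (negligibleS (A :=
  ((zeros f [set 1%:M] `\` zeros f A)
   `|` (zeros f A `\` zeros f (extend_refl A (d k))) : set (borelU4 R)))).
  move=> U [U1 UA]; case: (pselect (zeros f A U)) => h; [right|left]; by split.
apply: negligibleU => //.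
exists (zeros f A `\` zeros f (extend_refl A (d k))); split=> //.
  by apply: measurableD; apply: measurable_closedU4; apply: closed_zeros; case: fp.
exact: null_extend_refl fp (d1 k).
Qed.

End Haar.

Lemma closure_image (T U : topologicalType) (f : T -> U) (A : set T) (B : set U) :
  continuous f -> (forall x, A x -> closure B (f x)) ->
  forall x, closure A x -> closure B (f x).
Proof.
move=> cf AB; have cl : closed (f @^-1` closure B).
  by apply: closed_comp => [x _|]; [exact: cf|exact: closed_closure].
by move=> x Ax; apply: cl; apply: closure_subset Ax.
Qed.

Lemma closure_mulmx n (A : set 'M[C]_n) :
  (forall X Y, A X -> A Y -> A (X *m Y)) ->
  forall X Y, closure A X -> closure A Y -> closure A (X *m Y).
Proof.
move=> AM X Y AX AY.
apply: (@closure_image _ _ (fun Z : 'M[C]_n => Z *m Y) A A _ _ X AX) => [|X' AX'].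
  by apply: continuous_mulmx; [move=> ?; exact: cvg_id|exact: cst_continuous].
apply: (@closure_image _ _ (fun Z : 'M[C]_n => X' *m Z) A A _ _ Y AY) => [|Y' AY'].
  by apply: continuous_mulmx; [exact: cst_continuous|move=> ?; exact: cvg_id].
by apply: subset_closure; exact: AM.
Qed.

(** A unit vector with no zero coordinate in the standard basis. *)
Definition half_row : 'rV[C]_4 := const_mx (2^-1).

(** If [f] vanishes at [U], density provides a word [X] so close to [U0 U^-1] that [f (X U) != 0].
    So [U] lies in the exceptional set of that word's list of directions, and such lists are
    countable. *)
Lemma polyfun_negligible (mu : probability (borelU4 R) R) f (U0 : U4 R) :
  haar mu -> polyfun f -> f (U4mx U0) != 0 ->
  mu.-negligible [set U : borelU4 R | f (U4mx U) = 0].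
Proof.
move=> hmu [D fp] fU0.
pose d (k : option 'I_4) := if k is Some i then row i 1%:M else half_row.
have I1 : (1%:M : 'M[C]_4) \is unitarymx by exact: unitarymx1.
have h1 : dot half_row half_row = 1.
  rewrite dotE (eq_bigr (fun=> 4^-1)) => [|i _].
    by rewrite sumr_const card_ord -[_ *+ 4]mulr_natl divff ?pnatr_eq0.
  by rewrite mxE fmorphV /= conjC_nat -invfM -natrM.
have d1 k : dot (d k) (d k) = 1 by case: k => [i|] //=; rewrite dot_row ?eqxx.
pose Gam := [set X | exists ds, refl_words d ds X].
have GamR k z : `|z| = 1 -> closure Gam (refl (d k) z).
  move=> z1; apply: subset_closure; exists [:: k], 1%:M, z; split=> //.
  by rewrite mul1mx.
have dense V : V \is unitarymx -> closure Gam V.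
  apply: (reflections_generate _ _ _ I1 h1).
  - exact: closed_closure.
  - by apply: subset_closure; exists [::].
  - apply: closure_mulmx => X Y [ds1 X1] [ds2 Y2].
    by exists (ds2 ++ ds1); exact: refl_words_cat.
  - move=> i; rewrite row1 dotE (bigD1 i) //= big1.
      by rewrite !mxE !eqxx /= rmorph1 mulr1 addr0 invr_eq0 pnatr_eq0.
    by move=> j ji; rewrite !mxE eqxx (negbTE ji) /= rmorph0 mulr0.
  - by move=> i z; exact: (GamR (Some i)).
  - exact: (GamR None).
pose F n := if (unpickle n : option (seq (option 'I_4))) is Some ds
  then zeros f [set 1%:M] `\` zeros f (refl_words d ds) else set0.
apply: (negligibleS (A := \bigcup_n (F n : set (borelU4 R)))); last first.
  apply: negligible_bigcup => n; rewrite /F; case: unpickle => [ds|].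
    exact: negligible_refl_words fp d1.
  exact: negligible_set0.
move=> U fU.
have [X] : Gam `&` [set X | f (X *m U4mx U) != 0] !=set0.
  have := dense (U4mx U0 *m (U4mx U)^t*).
  rewrite mul_unitarymx ?trmxC_unitary ?U4mxP // => /(_ isT); apply.
  apply: open_nbhs_nbhs; split.
    have -> : [set X | f (X *m U4mx U) != 0] = ~` [set X | f (X *m U4mx U) = 0].
      by apply/seteqP; split => X /= /eqP.
    apply: closed_openC; apply: closed_fiber => X.
    have cU : continuous (fun X : 'M[C]_4 => X *m U4mx U).
      by apply: continuous_mulmx; [move=> ?; exact: cvg_id|exact: cst_continuous].
    exact: (continuous_comp (cU X) (fp.1 _)).
  rewrite /= -mulmxA; have := U4mxP U; rewrite -trmxC_unitary => /unitarymxP.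
  by rewrite trmxCK => ->; rewrite mulmx1.
move=> [[ds Xds] fX].
exists (pickle ds) => //; rewrite /F pickleK; split=> [_ ->|/(_ X Xds) fX0].
  by rewrite mul1mx.
by move: fX; rewrite /= fX0 eqxx.
Qed.

End PolynomialNullSets.

(** * Two-universality *)

Section Words.
Variable R : realType.
Local Notation C := R[i].

(** The monoid generated by [A] and [B], in a form suited to induction; [word_alt_word] returns to
    alternating powers. *)
Inductive word (A B : 'M[C]_4) : 'M[C]_4 -> Prop :=
| word1 : word A B 1
| wordA X : word A B X -> word A B (A * X)
| wordB X : word A B X -> word A B (B * X).

Lemma word_mul A B X Y : word A B X -> word A B Y -> word A B (X * Y).
Proof.
move=> X_ Y_; elim: X_ => [|Z _ IH|Z _ IH]; first by rewrite mul1r.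
  by rewrite -mulrA; exact: wordA.
by rewrite -mulrA; exact: wordB.
Qed.

Lemma word_expr A B k : word A B (A ^+ k).
Proof.
by elim: k => [|k IH]; [exact: word1|rewrite exprS; exact: wordA].
Qed.

Lemma eq_alt_word A B N N' l :
  (forall i, (i <= l)%N -> N i = N' i) ->
  alt_word A B N l = alt_word A B N' l :> 'M[C]_4.
Proof.
elim: l => //= l IH NN; rewrite NN //; congr (_ * _).
by apply: IH => i il; apply: NN; exact: leqW.
Qed.

Lemma alt_word_prepend A B N l (c : bool) : exists N' l',
  (if c then A else B) * alt_word A B N l = alt_word A B N' l' :> 'M[C]_4.
Proof.
(* Beyond [l] the exponent is 1 at positions of the wanted letter and 0 elsewhere, so a wrong letter
   at [l + 1] is skipped by a zeroth power. *)
pose N' i := if (i <= l)%N then N i else (odd i == c : nat).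
have NE : alt_word A B N l = alt_word A B N' l.
  by apply: eq_alt_word => i il; rewrite /N' il.
rewrite NE; have [lc|lc] := eqVneq (odd l.+1) c.
  exists N', l.+1.
  have -> : alt_word A B N' l.+1 =
    (if odd l.+1 then A else B) ^+ N' l.+1 * alt_word A B N' l by [].
  by rewrite {2}/N' ltnn lc eqxx expr1.
exists N', l.+2.
have -> : alt_word A B N' l.+2 = (if odd l.+2 then A else B) ^+ N' l.+2 *
  ((if odd l.+1 then A else B) ^+ N' l.+1 * alt_word A B N' l) by [].
have -> : N' l.+1 = 0 by rewrite /N' ltnn (negbTE lc).
have neqb (u v : bool) : u != v -> ~~ u = v by case: u; case: v.
have l2 : odd l.+2 = c by exact: neqb lc.
by rewrite /N' ltnNge leqnSn l2 eqxx expr1 expr0 mul1r.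
Qed.

Lemma word_alt_word A B X : word A B X -> exists N l, X = alt_word A B N l.
Proof.
elim=> [|Y _ [N [l ->]]|Y _ [N [l ->]]]; first by exists (fun=> 0%N), 0%N.
  have [N' [l' E]] := alt_word_prepend A B N l true.
  by exists N', l'.
have [N' [l' E]] := alt_word_prepend A B N l false.
by exists N', l'.
Qed.

Lemma normcE (x : C) : (Normc.normc x)%:C%C = `|x|.
Proof. by case: x => a b; rewrite normc_def. Qed.

(** The four entries of [A *m x] have modulus at most [4 * d], and [sqrt (4 * (4 d)^2) = 8 d]. *)
Lemma opnorm_le (A : 'M[C]_4) (d : R) :
  0 <= d -> (forall i j, `|A i j| <= d%:C%C) -> opnorm A <= 8 * d.
Proof.
move=> d0 Ad; apply: ge_sup.
  exists (l2norm (A *m 0)), 0 => //=.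
  by rewrite /l2norm big1 ?sqrtr0 // => i _; rewrite mxE Normc.normc0 expr0n.
move=> _ [x x1 <-]; rewrite /= in x1.
have S0 (y : 'cV[C]_4) : 0 <= \sum_(i < 4) Normc.normc (y i 0) ^+ 2.
  by apply: sumr_ge0 => i _; rewrite sqr_ge0.
have xj j : `|x j 0| <= 1.
  rewrite -normcE -[leRHS]/(1%:C%C) lecR; apply: le_trans x1.
  rewrite -[leLHS]ger0_norm -?sqrtr_sqr; last first.
    by rewrite -lecR normcE; exact: normr_ge0.
  by rewrite ler_sqrt // (bigD1 j) //= lerDl sumr_ge0 // => i _; rewrite sqr_ge0.
have Axi i : Normc.normc ((A *m x) i 0) <= 4 * d.
  rewrite -lecR normcE mxE; apply: le_trans (ler_norm_sum _ _ _) _.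
  apply: (@le_trans _ _ (\sum_(j < 4) d%:C%C)).
    apply: ler_sum => j _; rewrite normrM -[leRHS]mulr1; exact: ler_pM.
  by rewrite sumr_const card_ord rmorphM /= rmorph_nat mulr_natl.
apply: (@le_trans _ _ (Num.sqrt (\sum_(i < 4) (4 * d) ^+ 2))).
  rewrite ler_sqrt; last by apply: sumr_ge0 => i _; rewrite sqr_ge0.
  apply: ler_sum => i _; apply: lerXn2r; rewrite ?nnegrE ?mulr_ge0 //.
  by rewrite -lecR normcE; exact: normr_ge0.
rewrite sumr_const card_ord (_ : (4 * d) ^+ 2 *+ 4 = (8 * d) ^+ 2); last by ring.
by rewrite sqrtr_sqr ger0_norm // mulr_ge0.
Qed.

Lemma closure_opnorm (S : set 'M[C]_4) V (e : R) : closure S V -> 0 < e ->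
  exists2 X, S X & opnorm (V - X) < e.
Proof.
(* With this [d], the bound [8 * d] is half of [e]. *)
move=> SV e0; pose d := e / 16.
have d0 : 0 < d by rewrite divr_gt0.
have nV : nbhs V (ball V d%:C%C) by apply: nbhsx_ballx; rewrite ltcR.
have [X [SX VX]] := SV _ nV; exists X => //.
apply: (@le_lt_trans _ _ (8 * d)).
  apply: opnorm_le => [|i j]; first exact: ltW.
  by case: VX => _ VX; rewrite !mxE; apply: ltW; exact: VX.
rewrite /d mulrA [8 * e]mulrC -mulrA gtr_pMr // ltr_pdivrMr // mul1r.
by rewrite ltr_nat.
Qed.

End Words.

(** * Characteristic polynomials and resonant eigenvalues *)

Section CharPoly.
Variable R : realType.
Local Notation C := R[i].

Lemma polyfun_char_poly n k : polyfun (fun X : 'M[C]_n => (char_poly X)`_k).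
Proof.
(* Coefficientwise polynomial functions with values in [{poly C}]; being closed under products, they
   suit the Leibniz formula. *)
pose pp (F : 'M[C]_n -> {poly C}) := forall k, polyfun (fun X => (F X)`_k).
have ppM F G : pp F -> pp G -> pp (fun X => F X * G X).
  move=> pF pG m; under eq_fun do rewrite coefM.
  by apply: polyfun_sum => i; exact: (polyfunM (pF i) (pG _)).
have ppC p : pp (fun=> p) by move=> m; exact: polyfun_cst.
have pp_prod (I : Type) (r : seq I) (F : I -> 'M[C]_n -> {poly C}) :
    (forall i, pp (F i)) -> pp (fun X => \prod_(i <- r) F i X).
  move=> pF; elim: r => [|i r IH].
    by under eq_fun do rewrite big_nil; exact: ppC.
  by under eq_fun do rewrite big_cons; exact: (ppM _ _ (pF i) IH).
have pp_entry i j : pp (fun X => char_poly_mx X i j).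
  move=> m; under eq_fun do rewrite !mxE coefB coefC.
  apply: polyfunD; first exact: polyfun_cst.
  under eq_fun do rewrite -mulN1r.
  apply: polyfunM; first exact: polyfun_cst.
  by case: (m == 0)%N; [exact: polyfun_entry|exact: polyfun_cst].
rewrite /char_poly /determinant; under eq_fun do rewrite coef_sum.
apply: polyfun_sum => s; move: k.
exact: (ppM _ _ (ppC _) (pp_prod _ _ _ (fun i => pp_entry i (s i)))).
Qed.

Lemma char_poly_unitary n (P : 'M[C]_n) (d : 'rV[C]_n) : P \is unitarymx ->
  char_poly (P^t* *m diag_mx d *m P) = \prod_(i < n) ('X - (d 0 i)%:P).
Proof.
move=> Pu; have := char_poly_trig (diag_mx_is_trig d).
under eq_bigr do rewrite mxE eqxx mulr1n.
move=> <-; rewrite /char_poly /char_poly_mx !map_mxM /=.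
set Q := map_mx polyC P; set Q' := map_mx polyC (P^t*).
have QQ : Q' *m Q = 1%:M by rewrite -map_mxM unitarymx_trC // map_mx1.
have -> : 'X%:M - Q' *m map_mx polyC (diag_mx d) *m Q =
    Q' *m ('X%:M - map_mx polyC (diag_mx d)) *m Q.
  rewrite mulmxBr mulmxBl; congr (_ - _).
  by rewrite mul_mx_scalar -scalemxAl QQ scalemx1.
rewrite !det_mulmx mulrAC -det_mulmx QQ det1 mul1r.
by congr determinant.
Qed.

(** Quantifying over all diagonalisations covers every ordering of the eigenvalues and avoids
    choosing an eigenbasis. *)
Definition resonant (a b : 'I_4 -> nat) : set (U4 R) :=
  [set U | exists (P : 'M[C]_4) (d : 'rV[C]_4),
    [/\ P \is unitarymx, U4mx U = P^t* *m diag_mx d *m P &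
        \prod_i d 0 i ^+ a i = \prod_i d 0 i ^+ b i]].

(** Uniqueness of base [M] digits: reduce modulo [M], then divide by [M]. *)
Lemma digits_inj n (M : nat) (a b : 'I_n -> nat) :
  (forall i, a i < M)%N -> (forall i, b i < M)%N ->
  (\sum_i a i * M ^ i = \sum_i b i * M ^ i)%N -> a =1 b.
Proof.
elim: n a b => [|n IH] a b aM bM; first by move=> _ [].
rewrite !big_ord_recl /= !expn0 !muln1.
have shift (c : 'I_n.+1 -> nat) : (\sum_(i < n) c (lift ord0 i) * M ^ bump 0 i =
    (\sum_(i < n) c (lift ord0 i) * M ^ i) * M)%N.
  by rewrite big_distrl /=; apply: eq_bigr => i _; rewrite expnSr mulnA.
rewrite !shift => E.
have M0 : (0 < M)%N by exact: leq_ltn_trans (aM ord0).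
have E0 : a ord0 = b ord0.
  have := congr1 (modn^~ M) E; rewrite ![(_ + _ * M)%N]addnC !modnMDl.
  by rewrite !modn_small.
have E1 : (\sum_(i < n) a (lift ord0 i) * M ^ i =
    \sum_(i < n) b (lift ord0 i) * M ^ i)%N.
  by move/eqP: E; rewrite E0 eqn_add2l eqn_pmul2r // => /eqP.
have := IH (fun i => a (lift ord0 i)) (fun i => b (lift ord0 i)) _ _ E1.
move=> H i; case: (unliftP ord0 i) => [j ->|-> //].
exact: H.
Qed.

(* Symmetrising the relation over all orderings of the eigenvalues turns it
   into a polynomial in the coefficients of [char_poly].  It does not vanish at
   the diagonal matrix with entries [z ^+ (M ^ i)], where [M] exceeds all
   exponents and [z] avoids finitely many values. *)
Lemma negligible_resonant (mu : probability (borelU4 R) R) (a b : 'I_4 -> nat) :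
  haar mu -> ~ a =1 b -> mu.-negligible (resonant a b : set (borelU4 R)).
Proof.
move=> hmu ab.
have [r rE] := SymmetricFunctions.symmetrized_relation C a b.
pose f (X : 'M[C]_4) := \sum_(cm <- r) cm.1 * \prod_(i < 4)
  ((-1) ^+ i.+1 * (char_poly X)`_(4 - i.+1)) ^+ cm.2 i.
have pf : polyfun f.
  apply: polyfun_sum => cm; apply: polyfunM; first exact: polyfun_cst.
  apply: polyfun_prod => i; apply: polyfunX; apply: polyfunM.
    exact: polyfun_cst.
  exact: polyfun_char_poly.
have fE (P : 'M[C]_4) (d : 'rV[C]_4) : P \is unitarymx ->
    f (P^t* *m diag_mx d *m P) = \prod_(s : 'S_4)
      (\prod_i d 0 (s i) ^+ a i - \prod_i d 0 (s i) ^+ b i).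
  move=> Pu; rewrite /f char_poly_unitary //.
  have := rE [tuple d 0 i | i < 4]; rewrite big_tuple.
  under [X in _ = X -> _]eq_bigr do
    (under eq_bigr do rewrite tnth_mktuple;
     under [X in _ - X]eq_bigr do rewrite tnth_mktuple).
  move=> <-; apply: eq_bigr => cm _; congr (_ * _); apply: eq_bigr => i _.
  by congr ((_ * (polyseq _)`_ _) ^+ _); apply: eq_bigr => j _; rewrite tnth_mktuple.
pose M := (\sum_i a i + \sum_i b i).+1.
have aM i : (a i < M)%N.
  by rewrite ltnS (bigD1 i) //= -addnA leq_addr.
have bM i : (b i < M)%N.
  by rewrite ltnS [X in (_ <= _ + X)%N](bigD1 i) //= addnCA leq_addr.
(* The exponent of [z] in a permuted monomial evaluated at the diagonal matrix [d0]. *)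
pose ex (c : 'I_4 -> nat) (s : 'S_4) := (\sum_i c i * M ^ (s i))%N.
have exN s : ex a s != ex b s.
  apply/eqP => E; apply: ab => i.
  have := @digits_inj 4 M (fun i => a ((s^-1)%g i))
    (fun i => b ((s^-1)%g i)) _ _ _ (s i).
  rewrite /= permK; apply=> //.
  move: E; rewrite /ex (reindex_inj (@perm_inj _ (s^-1)%g)).
  rewrite [in RHS](reindex_inj (@perm_inj _ (s^-1)%g)).
  by under eq_bigr do rewrite permKV; under [in RHS]eq_bigr do rewrite permKV.
pose q : {poly C} := \prod_(s : 'S_4) ('X^(ex a s) - 'X^(ex b s)).
have q0 : q != 0.
  rewrite prodf_seq_neq0; apply/allP => s _ /=; rewrite subr_eq0.
  apply/eqP => /(congr1 (fun p : {poly C} => size p)); rewrite !size_polyXn => -[].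
  by apply/eqP; exact: exN.
have [k qk] : exists k, ~~ root q (unit_point R k).
  apply: contrapT => noex.
  have := @max_poly_roots _ q [seq unit_point R k | k <- iota 0 (size q)] q0.
  rewrite size_map size_iota ltnn => H; suff : false by []. apply: H.
    apply/allP => _ /mapP[k _ ->]; apply: contrapT => /negP nr.
    by apply: noex; exists k.
  by rewrite map_inj_uniq ?iota_uniq //; exact: unit_point_inj.
pose z := unit_point R k.
pose d0 : 'rV[C]_4 := \row_i z ^+ (M ^ i).
have I1 : (1%:M : 'M[C]_4) \is unitarymx by exact: unitarymx1.
have D0u : diag_mx d0 \is unitarymx.
  apply/unitarymxP; rewrite tr_diag_mx map_diag_mx mulmx_diag.
  rewrite -[RHS]diag_const_mx; congr diag_mx; apply/rowP => i; rewrite !mxE.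
  by rewrite -normCK normrX norm_unit_point !expr1n.
have fU0 : f (U4mx (mkU4 D0u)) != 0.
  have -> : U4mx (mkU4 D0u) = (1%:M)^t* *m diag_mx d0 *m 1%:M.
    by rewrite trmx1 map_mx1 mul1mx mulmx1.
  rewrite fE //; move: qk; rewrite /root /q horner_prod; apply: contra_neq => <-.
  apply: eq_bigr => s _; rewrite hornerD hornerN !hornerXn.
  by congr (_ - _); rewrite /ex -prodrXr; apply: eq_bigr => i _;
    rewrite mxE -exprM mulnC.
apply: negligibleS (polyfun_negligible hmu pf fU0).
move=> U [P [d [Pu UE dE]]]; rewrite /= UE fE //.
(* A resonance of [U] kills the factor of the identity permutation. *)
rewrite (bigD1 1%g) //=; under eq_bigr do rewrite perm1.
by under [X in _ - X]eq_bigr do rewrite perm1; rewrite dE subrr mul0r.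
Qed.

End CharPoly.

(** * The singlet vector and the density of generic words *)

Section Universality.
Context {R : realType}.
Local Notation C := R[i].

(** Left unnormalised: its squared norm 2 makes [1 - s^* s] the reflection with eigenvalue -1. *)
Definition singlet : 'rV[C]_4 := \row_j ([:: 0; 1; -1; 0]`_j).

Lemma swapmxE : swapmx = 1%:M - singlet^t* *m singlet :> 'M[C]_4.
Proof.
apply/matrixP => i j; rewrite !mxE big_ord1 !mxE.
case: i => -[|[|[|[|//]]]] hi; case: j => -[|[|[|[|//]]]] hj;
  rewrite /= ?rmorphN ?conjC0 ?conjC1 /= ?conjC0 ?conjC1 ?mulr0n ?mulr1n; ring.
Qed.

Lemma dot_singlet : dot singlet singlet = 2.
Proof.
rewrite dotE !big_ord_recl big_ord0 !mxE /= rmorphN /= conjC0 conjC1; ring.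
Qed.

Lemma mul_swapmx (x : 'rV[C]_4) : x *m swapmx = x - dot x singlet *: singlet.
Proof. by rewrite swapmxE mulmxBr mulmx1 mulmx_outer. Qed.

Lemma swapmxK : swapmx *m swapmx = 1%:M :> 'M[C]_4.
Proof.
apply/row_matrixP => i; rewrite !rowE mulmxA mulmx1 !mul_swapmx -!scaleNr.
rewrite dotDl dotZl dot_singlet -addrA -scalerDl.
set c := dot _ _; have -> : - c + - (c + - c * 2) = 0 by ring.
by rewrite scale0r addr0.
Qed.

Lemma swapmx_tr : swapmx^t* = swapmx :> 'M[C]_4.
Proof.
rewrite swapmxE linearB /= map_mxB trmx1 map_mx1.
by rewrite trmx_mul map_mxM /= trmxCK.
Qed.

Lemma swapmx_unitary : (swapmx : 'M[C]_4) \is unitarymx.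
Proof. by apply/unitarymxP; rewrite swapmx_tr swapmxK. Qed.

(** Its determinant is a polynomial test that the singlet is orthogonal to no eigenvector of [X],
    for unitary [X]. *)
Definition krylov (X : 'M[C]_4) : 'M[C]_4 :=
  \matrix_(k < 4) (singlet *m X ^+ k).

Lemma polyfun_det n (F : 'M[C]_n -> 'M[C]_n) :
  (forall i j, polyfun (fun X => F X i j)) -> polyfun (fun X => \det (F X)).
Proof.
move=> pF; rewrite /determinant; apply: polyfun_sum => s.
by apply: polyfunM; [exact: polyfun_cst|apply: polyfun_prod => i].
Qed.

Lemma polyfun_krylov : polyfun (fun X => \det (krylov X)).
Proof.
have pX (k : nat) : forall i j, polyfun (fun X : 'M[C]_4 => (X ^+ k) i j).
  elim: k => [|k IH] i j; first exact: polyfun_cst.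
  under eq_fun do rewrite exprS mxE.
  by apply: polyfun_sum => l; apply: polyfunM; [exact: polyfun_entry|exact: IH].
apply: polyfun_det => i j; under eq_fun do rewrite !mxE.
by apply: polyfun_sum => k; apply: polyfunM; [exact: polyfun_cst|exact: pX].
Qed.

(** An eigenvector orthogonal to the singlet [s] is orthogonal to every [s X^k], so the Krylov rows
    do not span. *)
Lemma krylov_singular (P : 'M[C]_4) (d : 'rV[C]_4) p : P \is unitarymx ->
  dot singlet (row p P) = 0 -> \det (krylov (P^t* *m diag_mx d *m P)) = 0.
Proof.
move=> Pu sp; set X := _ *m P.
have PP := unitarymxP Pu.
have Xf : row p P *m X^t* = (d 0 p)^* *: row p P.
  rewrite /X !trmx_mul !map_mxM /= trmxCK tr_diag_mx map_diag_mx.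
  rewrite !mulmxA rowE -(mulmxA (delta_mx 0 p)) PP mulmx1 -rowE row_diag_mx.
  by rewrite -scalemxAl -rowE mxE.
have dotX (k : nat) : dot (singlet *m X ^+ k) (row p P) = 0.
  elim: k => [|k IH]; first by rewrite expr0 mulmx1.
  by rewrite exprSr mulmxA dot_mulmx Xf dotZr IH mulr0.
rewrite -det_tr; apply/eqP/det0P; exists (map_mx Num.conj (row p P)).
  rewrite map_mx_eq0; apply/eqP => f0.
  have := dot_row p p Pu; rewrite f0 dot0l eqxx => /eqP.
  by rewrite eq_sym oner_eq0.
apply/rowP => k; rewrite !mxE -[RHS](dotX k) dotE; apply: eq_bigr => j _.
by rewrite !mxE mulrC.
Qed.

(** A unitary with nonzero Krylov determinant. The sign matters: the plain cyclic shift fixes the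
    all-ones vector, which is orthogonal to the singlet. *)
Definition signed_shift : 'M[C]_4 := \matrix_(i < 4, j < 4)
  (nth [::] [:: [:: 0; 1; 0; 0];
                [:: 0; 0; 1; 0];
                [:: 0; 0; 0; 1];
                [:: -1; 0; 0; 0]] i)`_j.

Lemma signed_shift_unitary : signed_shift \is unitarymx.
Proof.
apply/unitarymxP/matrixP => i j; rewrite !mxE !big_ord_recl big_ord0 !mxE.
case: i => -[|[|[|[|//]]]] hi; case: j => -[|[|[|[|//]]]] hj;
  rewrite /= ?rmorphN /= ?conjC0 ?conjC1 ?mulr0n ?mulr1n; ring.
Qed.

Lemma mul_signed_shift (x0 x1 x2 x3 : C) :
  (\row_j ([:: x0; x1; x2; x3]`_j)) *m signed_shift
  = \row_j ([:: - x3; x0; x1; x2]`_j).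
Proof.
apply/rowP => j; rewrite !mxE !big_ord_recl big_ord0 !mxE.
by case: j => -[|[|[|[|//]]]] hj; rewrite /=; ring.
Qed.

Lemma krylov_signed_shift : \det (krylov signed_shift) != 0.
Proof.
have k0 : singlet *m signed_shift ^+ 0 = singlet by rewrite expr0 mulmx1.
have k1 : singlet *m signed_shift ^+ 1 = \row_j ([:: - 0; 0; 1; -1]`_j).
  by rewrite exprSr mulmxA k0 mul_signed_shift.
have k2 : singlet *m signed_shift ^+ 2 = \row_j ([:: - -1; - 0; 0; 1]`_j).
  by rewrite exprSr mulmxA k1 mul_signed_shift.
have k3 : singlet *m signed_shift ^+ 3 = \row_j ([:: - 1; - -1; - 0; 0]`_j).
  by rewrite exprSr mulmxA k2 mul_signed_shift.
have KE : krylov signed_shift = \matrix_(k < 4, j < 4)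
    (nth [::] [:: [:: 0; 1; -1; 0];
                  [:: 0; 0; 1; -1];
                  [:: 1; 0; 0; 1];
                  [:: -1; 1; 0; 0]] k)`_j.
  apply/row_matrixP => k; rewrite rowK.
  case: k => -[|[|[|[|//]]]] hk; rewrite ?k0 ?k1 ?k2 ?k3;
    apply/rowP => -[[|[|[|[|//]]]] hj];
    by rewrite !mxE /= ?oppr0 ?opprK.
apply/det0P => -[v v0 vK].
pose a k := v 0 (inord k).
have vE : v = \row_j a j by apply/rowP => j; rewrite mxE /a inord_val.
have e j : ((\row_j a j) *m krylov signed_shift) 0 j = 0.
  by rewrite -vE vK mxE.
have e0 : a 2%N - a 3%N = 0.
  rewrite -[RHS](e (inord 0)) KE mxE !big_ord_recl big_ord0 !mxE /=.
  by rewrite inordK //=; ring.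
have e1 : a 0%N + a 3%N = 0.
  rewrite -[RHS](e (inord 1)) KE mxE !big_ord_recl big_ord0 !mxE /=.
  by rewrite inordK //=; ring.
have e2 : a 1%N - a 0%N = 0.
  rewrite -[RHS](e (inord 2)) KE mxE !big_ord_recl big_ord0 !mxE /=.
  by rewrite inordK //=; ring.
have e3 : a 2%N - a 1%N = 0.
  rewrite -[RHS](e (inord 3)) KE mxE !big_ord_recl big_ord0 !mxE /=.
  by rewrite inordK //=; ring.
have n2 : (2 : C) != 0 by rewrite pnatr_eq0.
have a0 : a 0%N = 0.
  (* In this combination everything cancels except [2 * a 0]. *)
  apply: (mulfI n2); transitivity ((a 0%N + a 3%N) + (a 2%N - a 3%N)
    - (a 2%N - a 1%N) - (a 1%N - a 0%N)); first by ring.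
  by rewrite e0 e1 e2 e3 mulr0 !subr0 addr0.
have a1 : a 1%N = 0 by move: e2; rewrite a0 subr0.
have a2 : a 2%N = 0 by move: e3; rewrite a1 subr0.
have a3 : a 3%N = 0 by move: e1; rewrite a0 add0r.
move/eqP: v0; apply; rewrite vE; apply/rowP => -[[|[|[|[|//]]]] hj];
  by rewrite !mxE /= ?a0 ?a1 ?a2 ?a3.
Qed.

(** The determinant hypothesis gives the singlet nonzero coordinates in the eigenbasis; the absence
    of resonances is what Kronecker's theorem requires. *)
Lemma generic_density (U : U4 R) :
  \det (krylov (U4mx U)) != 0 ->
  (forall a b : 'I_4 -> nat, resonant a b U -> a =1 b) ->
  two_universal U.
Proof.
move=> Ukry Ures V e e0.
have [P [d [Pu d1 UE]]] := unitary_spectral (U4mxP U).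
set T := swapmx; set W := T * U4mx U * T.
pose S : set 'M[C]_4 := word (U4mx U) W.
suff SV : closure S (U4mx V).
  have [X SX VX] := closure_opnorm SV e0.
  have [N [l XE]] := word_alt_word SX.
  by exists l, N; rewrite -XE.
have TT : T * T = 1 := swapmxK.
have S1 : closure S 1%:M by apply: subset_closure; exact: word1.
have SM X Y : closure S X -> closure S Y -> closure S (X *m Y).
  by apply: closure_mulmx => A B; exact: word_mul.
(* Conjugation by [T] exchanges the two letters. *)
have swapS X : S X -> S (T * X * T).
  elim=> [|Y _ IH|Y _ IH]; first by rewrite mulr1 TT; exact: word1.
    rewrite (_ : T * _ * T = W * (T * Y * T)); first exact: wordB.
    by rewrite /W -!mulrA (mulrA T T) TT mul1r.
  rewrite (_ : T * _ * T = U4mx U * (T * Y * T)); first exact: wordA.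
  by rewrite /W !mulrA TT mul1r.
have conj_cont (A B : 'M[C]_4) : continuous (fun X : 'M[C]_4 => A *m X *m B).
  apply: continuous_mulmx; last exact: cst_continuous.
  by apply: continuous_mulmx; [exact: cst_continuous|move=> ?; exact: cvg_id].
have swapG X : closure S X -> closure S (T *m X *m T).
  apply: (@closure_image _ _ (fun X : 'M[C]_4 => T *m X *m T) S S
    (conj_cont T T)) => Y SY.
  by apply: subset_closure; exact: swapS.
have indep (a b : 'I_4 -> nat) :
    \prod_i d 0 i ^+ a i = \prod_i d 0 i ^+ b i -> a =1 b.
  by move=> dab; apply: Ures; exists P, d.
(* By Kronecker's theorem the powers of the eigenvalue vector, which come from powers of [U], are
   dense in the torus. *)
have torus (tau : 'rV[C]_4) : (forall i, `|tau 0 i| = 1) ->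
    closure S (P^t* *m diag_mx tau *m P).
  move=> tau1.
  pose D : set 'rV[C]_4 := [set x | exists n : nat, x = \row_i d 0 i ^+ n].
  apply: (@closure_image _ _ (fun x : 'rV[C]_4 => P^t* *m diag_mx x *m P) D S).
  - move=> x; apply: (@continuous_comp _ _ _ (fun x : 'rV[C]_4 => diag_mx x)
      (fun X => P^t* *m X *m P)); last exact: conj_cont.
    move: x; apply: continuous_mx => i j; under eq_fun do rewrite mxE.
    case: (i == j); first by under eq_fun do rewrite mulr1n; exact: coord_continuous.
    by under eq_fun do rewrite mulr0n; exact: cst_continuous.
  - move=> _ [n ->]; apply: subset_closure.
    rewrite (_ : _ *m P = U4mx U ^+ n); first exact: word_expr.
    elim: n => [|n IH].
      rewrite expr0 (_ : diag_mx _ = 1%:M) ?mulmx1 ?unitarymx_trC //.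
      by rewrite -diag_const_mx; congr diag_mx; apply/rowP => i; rewrite !mxE.
    have -> : U4mx U ^+ n.+1 = U4mx U ^+ n *m U4mx U by rewrite exprSr.
    rewrite -IH UE (unitary_conj_mul _ _ Pu) mulmx_diag.
    have dE : \row_i d 0 i ^+ n.+1 = \row_j ((\row_i d 0 i ^+ n) 0 j * d 0 j).
      by apply/rowP => i; rewrite !mxE exprSr.
    by rewrite dE.
  - move=> A /nbhs_ballP[r /= r0 rA].
    have [n hn] := kronecker (fun i => d1 i) tau1 indep r0.
    exists (\row_i d 0 i ^+ n); split; first by exists n.
    apply: rA; split=> // i j; rewrite (ord1 i) !mxE.
    by rewrite /ball /= distrC; exact: hn.
have reflP p z : `|z| = 1 -> closure S (refl (row p P) z).
  move=> z1; rewrite (refl_row p z Pu); apply: torus => i; rewrite mxE.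
  by case: eqP => // _; rewrite normr1.
have sP p : dot singlet (row p P) != 0.
  by apply: contra_neq Ukry => sp; rewrite UE (krylov_singular d Pu sp).
(* The squared moduli of the four coordinates of the singlet add up to 2, so they are not all 1. *)
have [j sj] : exists j, `|dot singlet (row j P)| ^+ 2 != 1.
  apply: contrapT => nosj.
  have s1 j : `|dot singlet (row j P)| ^+ 2 = 1.
    by apply/eqP; apply: contrapT => /negP h; apply: nosj; exists j.
  have : dot (singlet : 'rV[C]_4) singlet = 2 := dot_singlet.
  rewrite {1}(row_expansion (singlet : 'rV[C]_4) Pu) dot_suml.
  under eq_bigr do rewrite dotZl [dot (row _ _) _]dotC -normCK s1.
  rewrite sumr_const card_ord => /eqP.
  by rewrite eqr_nat.
pose w := row j P *m T.
have w1 : dot w w = 1.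
  by rewrite (dot_unitary _ _ swapmx_unitary) (dot_row j j Pu) eqxx.
apply: (reflections_generate _ S1 SM Pu w1 _ reflP _ (U4mxP V)).
- exact: closed_closure.
(* The coordinate of [w] along [row j P] is 1 minus the squared modulus that differs from 1; any
   other is, up to sign and conjugation, a product of two nonzero coordinates of the singlet. *)
- move=> p; rewrite /w mul_swapmx -scaleNr dotDl dotZl dot_row // mulNr.
  have [<-|jp] := eqVneq j p.
    by rewrite [dot (row j P) _]dotC -normCKC subr_eq0 eq_sym.
  rewrite sub0r oppr_eq0 mulf_neq0 // [dot (row j P) _]dotC conjC_eq0.
  exact: sP.
- move=> z z1; rewrite -(refl_conj _ _ swapmx_unitary) swapmx_tr.
  by apply: swapG; exact: reflP.
Qed.

End Universality.

Theorem theorem4 (R : realType) (mu : probability (borelU4 R) R) :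
  haar mu -> {ae mu, forall U : U4 R, two_universal U}.
Proof.
move=> hmu.
(* Exponent vectors are finite functions here, a countable type, so the resonances form a countable
   union. *)
pose F n : set (borelU4 R) :=
  if (unpickle n : option ({ffun 'I_4 -> nat} * {ffun 'I_4 -> nat})) is Some (a, b)
  then if a == b then set0 else resonant a b else set0.
have negF : mu.-negligible (\bigcup_n F n).
  apply: negligible_bigcup => n; rewrite /F.
  case: unpickle => [[a b]|]; last exact: negligible_set0.
  have [_|ab] := eqVneq a b; first exact: negligible_set0.
  apply: negligible_resonant => // e; move/eqP: ab; apply; exact/ffunP.
(* The signed shift shows that the Krylov determinant does not vanish identically on U(4). *)
have kry := @krylov_signed_shift R.
rewrite -(mkU4K (@signed_shift_unitary R)) in kry.
have negK := polyfun_negligible hmu (@polyfun_krylov R) kry.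
apply: negligibleS (negligibleU negF negK).
move=> U /= nU; apply: contrapT => good; apply: nU; apply: generic_density.
  by apply/eqP => K0; apply: good; right.
move=> a b ab; apply: contrapT => nab; apply: good; left.
pose a' := [ffun i => a i]; pose b' := [ffun i => b i].
exists (pickle (a', b')) => //; rewrite /F pickleK.
have -> : (a' == b') = false.
  by apply/eqP => /ffunP e; apply: nab => i; have := e i; rewrite !ffunE.
move: ab => [P [d [Pu UE dE]]]; exists P, d; split=> //.
by under eq_bigr do rewrite ffunE; under [RHS]eq_bigr do rewrite ffunE.
Qed.
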